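(* Let $\mathfrak g=\mathfrak{osp}(m|2n)$ with $M=m-2n\notin\{1,2\}$, let $\lambda\in\mathbb C$, and let $\mathfrak J^1_\lambda\subset\mathcal U(\mathfrak g)$ be the two-sided ideal generated by the elements $XY+(-1)^{|X||Y|}YX-2X\circledcirc_1Y-2\lambda\langle X,Y\rangle$ for $X,Y\in\mathfrak g$ (here $X\circledcirc_1Y\in\mathfrak g\otimes\mathfrak g$ is mapped to $\mathcal U(\mathfrak g)$ by the canonical projection $\otimes\mathfrak g\to\mathcal U(\mathfrak g)$). Then: (i) if $\lambda\ne-\frac{M-4}{4(M-1)}$ and $\lambda\ne0$, then $\mathfrak J^1_\lambda=\mathcal U(\mathfrak g)$; (ii) if $\lambda=0$ and $M\neq4$, then $\mathfrak J^1_\lambda=\mathcal U(\mathfrak g)\mathfrak g$ (the augmentation ideal); (iii) if $\lambda=-\frac{M-4}{4(M-1)}$, then $\mathfrak J^1_\lambda$ has infinite codimension in $\mathcal U(\mathfrak g)$.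
   Context: Conventions: $\mathbb C^{m|2n}$ with parity $[a]=0$ for $a\le m$, $[a]=1$ otherwise; orthosymplectic metric $g_{ab}$ (invertible, $g_{ab}=0$ if $[a]\ne[b]$, $g_{ba}=(-1)^{[a][b]}g_{ab}$), $g^{ab}=g_{ab}$, indices raised/lowered by $V_a=\sum_bg_{ab}V^b$, $V^c=\sum_ag^{ac}V_a$; $M=m-2n$; standing assumption $m>4$, $n>1$. $\mathfrak g=\mathfrak{osp}(m|2n)$ is identified with tensors $A^{ab}=-(-1)^{[a][b]}A^{ba}$ with invariant form $\langle U,V\rangle=\sum_{a,b}U_{ab}V^{ba}$. $\mathfrak g\otimes\mathfrak g$ is identified with tensors $T^{abcd}$ super-antisymmetric in $(a,b)$ and in $(c,d)$; $\mathfrak g\odot\mathfrak g$ (resp. $\mathfrak g\wedge\mathfrak g$) are those with $T^{abcd}=\pm(-1)^{([a]+[b])([c]+[d])}T^{cdab}$ (sign $+$, resp. $-$). Define $q(V)^{abcd}=\frac13\big(V^{abcd}+(-1)^{[a]([b]+[c])}V^{bcad}-(-1)^{[b][c]}V^{acbd}\big)$ on $\mathfrak g\odot\mathfrak g$ and $\phi(X)^{abcd}=\frac14\big(g^{bc}X^{ad}-(-1)^{[a][b]}g^{ac}X^{bd}-(-1)^{[c][d]}g^{bd}X^{ac}+(-1)^{[a][b]+[c][d]}g^{ad}X^{bc}\big)$ for $X\in\mathbb C^{m|2n}\otimes\mathbb C^{m|2n}$. The first Cartan product is $\mathfrak g\circledcirc_1\mathfrak g=\{V\in\mathfrak g\odot\mathfrak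 g:\sum_{b,c}g_{bc}V^{acbd}=0,\ q(V)=0\}$; for $M\notin\{1,2\}$, $\mathfrak g\otimes\mathfrak g=(\mathfrak g\circledcirc_1\mathfrak g)\oplus\mathrm{Im}(q)\oplus\phi(\mathbb C^{m|2n}\odot\mathbb C^{m|2n})\oplus(\mathfrak g\wedge\mathfrak g)$, and $X\circledcirc_1Y$ denotes the component of $X\otimes Y$ in $\mathfrak g\circledcirc_1\mathfrak g$. For $\lambda=-\frac{M-4}{4(M-1)}$ the ideal $\mathfrak J^1:=\mathfrak J^1_\lambda$ is called the Joseph ideal of $\mathfrak{osp}(m|2n)$. *)

(* Defs.v *)
From HB Require Import structures.
From mathcomp Require Import all_boot all_order all_algebra.
Set Implicit Arguments. Unset Strict Implicit. Unset Printing Implicit Defensive.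
Import Order.TTheory GRing.Theory Num.Theory.
Local Open Scope ring_scope.

Section Osp.
Variable F : numClosedFieldType.
Variables m n : nat.
(* indices of C^{m|2n}: 'I_(m + 2n); index a is odd iff m <= a *)
Local Notation I := 'I_(m + n.*2).

Definition par (a : I) : bool := (m <= a)%N.
Definition sgn (b : bool) : F := if b then -1 else 1.

(* orthosymplectic metric with g^{ab} = g_{ab}; raising/lowering consistency:
   V^c = sum_a g^{ac} V_a with V_a = sum_b g_{ab} V^b, i.e. sum_a g_ac g_ab = delta_cb *)
Definition is_osp_metric (g : I -> I -> F) : Prop :=
  [/\ forall a b, par a != par b -> g a b = 0,
      forall a b, g b a = sgn (par a && par b) * g a b
    & forall b c, \sum_(a : I) g a c * g a b = (b == c)%:R].

Variable g : I -> I -> F.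

Definition in_g (A : I -> I -> F) : Prop :=
  forall a b, A a b = - (sgn (par a && par b) * A b a).

Definition homog (p : bool) (A : I -> I -> F) : Prop :=
  forall a b, A a b != 0 -> par a (+) par b = p.

(* super Lie bracket of homogeneous X (parity p), Y (parity q):
   X acts on C^{m|2n} as the matrix X g^T *)
Definition bracket (p q : bool) (X Y : I -> I -> F) : I -> I -> F :=
  fun a b => \sum_(c : I) \sum_(d : I)
    (X a c * g d c * Y d b - sgn (p && q) * (Y a c * g d c * X d b)).

Definition lower2 (U : I -> I -> F) : I -> I -> F :=
  fun a b => \sum_(c : I) \sum_(d : I) g a c * g b d * U c d.

Definition form (U V : I -> I -> F) : F :=
  \sum_(a : I) \sum_(b : I) lower2 U a b * V b a.

Definition in_gg (T : I -> I -> I -> I -> F) : Prop :=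
  (forall a b c d, T a b c d = - (sgn (par a && par b) * T b a c d)) /\
  (forall a b c d, T a b c d = - (sgn (par c && par d) * T a b d c)).

Definition sym_gg (T : I -> I -> I -> I -> F) : Prop :=
  in_gg T /\ forall a b c d,
    T a b c d = sgn ((par a (+) par b) && (par c (+) par d)) * T c d a b.

Definition asym_gg (T : I -> I -> I -> I -> F) : Prop :=
  in_gg T /\ forall a b c d,
    T a b c d = - (sgn ((par a (+) par b) && (par c (+) par d)) * T c d a b).

Definition qmap (V : I -> I -> I -> I -> F) : I -> I -> I -> I -> F :=
  fun a b c d => 3%:R^-1 * (V a b c d
    + sgn (par a && (par b (+) par c)) * V b c a d
    - sgn (par b && par c) * V a c b d).

Definition sym2 (X : I -> I -> F) : Prop :=
  forall a b, X a b = sgn (par a && par b) * X b a.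

Definition phimap (X : I -> I -> F) : I -> I -> I -> I -> F :=
  fun a b c d => 4%:R^-1 * (g b c * X a d
    - sgn (par a && par b) * (g a c * X b d)
    - sgn (par c && par d) * (g b d * X a c)
    + sgn ((par a && par b) (+) (par c && par d)) * (g a d * X b c)).

Definition cartan1 (V : I -> I -> I -> I -> F) : Prop :=
  [/\ sym_gg V,
      forall a d, \sum_(b : I) \sum_(c : I) g b c * V a c b d = 0
    & forall a b c d, qmap V a b c d = 0].

Definition cartan1_complement (W : I -> I -> I -> I -> F) : Prop :=
  exists U S Z, [/\ sym_gg U, sym2 S, asym_gg Z &
    forall a b c d, W a b c d = qmap U a b c d + phimap S a b c d + Z a b c d].

Definition cartan1_component (T V : I -> I -> I -> I -> F) : Prop :=
  cartan1 V /\ cartan1_complement (fun a b c d => T a b c d - V a b c d).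

(* an element is the family of its components t(i_1,...,i_k) *)
Definition tens := seq I -> F.

Definition tzero : tens := fun _ => 0.
Definition tone : tens := fun s => if s is [::] then 1 else 0.
Definition tadd (t u : tens) : tens := fun s => t s + u s.
Definition tscale (c : F) (t : tens) : tens := fun s => c * t s.
Definition tmul (t u : tens) : tens :=
  fun s => \sum_(i < (size s).+1) t (take i s) * u (drop i s).
Definition emb2 (X : I -> I -> F) : tens :=
  fun s => if s is [:: a; b] then X a b else 0.
Definition emb4 (T : I -> I -> I -> I -> F) : tens :=
  fun s => if s is [:: a; b; c; d] then T a b c d else 0.

(* T(g): subalgebra generated by g inside T(C^{m|2n}) *)
Inductive inTg : tens -> Prop :=
| Tg_one : inTg tone
| Tg_emb X : in_g X -> inTg (emb2 X)
| Tg_add t u : inTg t -> inTg u -> inTg (tadd t u)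
| Tg_scale c t : inTg t -> inTg (tscale c t)
| Tg_mul t u : inTg t -> inTg u -> inTg (tmul t u)
| Tg_ext t u : (forall s, t s = u s) -> inTg t -> inTg u.

Inductive tideal (S : tens -> Prop) : tens -> Prop :=
| ti_gen t : S t -> tideal S t
| ti_zero : tideal S tzero
| ti_add t u : tideal S t -> tideal S u -> tideal S (tadd t u)
| ti_scale c t : tideal S t -> tideal S (tscale c t)
| ti_mull u t : inTg u -> tideal S t -> tideal S (tmul u t)
| ti_mulr t u : inTg u -> tideal S t -> tideal S (tmul t u)
| ti_ext t u : (forall s, t s = u s) -> tideal S t -> tideal S u.

(* defining relations of U(g) = T(g)/<relU> *)
Definition relU (t : tens) : Prop :=
  exists p q X Y, [/\ in_g X, in_g Y, homog p X, homog q Y &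
    t = tadd (tadd (tmul (emb2 X) (emb2 Y))
                   (tscale (- sgn (p && q)) (tmul (emb2 Y) (emb2 X))))
             (tscale (-1) (emb2 (bracket p q X Y)))].

Definition joseph_gen (lam : F) (t : tens) : Prop :=
  exists p q X Y V, [/\ in_g X /\ in_g Y, homog p X, homog q Y,
    cartan1_component (fun a b c d => X a b * Y c d) V &
    t = tadd (tadd (tmul (emb2 X) (emb2 Y))
                   (tscale (sgn (p && q)) (tmul (emb2 Y) (emb2 X))))
             (tadd (tscale (- 2%:R) (emb4 V))
                   (tscale (- (2%:R * lam * form X Y)) tone))].

(* preimage in T(g) of the ideal J^1_lam of U(g) *)
Definition J1 (lam : F) : tens -> Prop :=
  tideal (fun t => relU t \/ joseph_gen lam t).

(* preimage in T(g) of the augmentation ideal U(g) g *)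
Definition augU : tens -> Prop :=
  tideal (fun t => relU t \/ exists X, in_g X /\ t = emb2 X).

(* an ideal (containing the relations of U(g)) has infinite codimension in U(g):
   for every k there are k elements of U(g) linearly independent modulo it *)
Definition infinite_codim (J : tens -> Prop) : Prop :=
  forall k : nat, exists ts : 'I_k -> tens,
    (forall i, inTg (ts i)) /\
    forall c : 'I_k -> F,
      J (fun s => \sum_(i < k) c i * ts i s) -> forall i, c i = 0.

End Osp.

Definition Mint (m n : nat) : int := (m%:Z - (n.*2)%:Z)%R.

Definition joseph_lambda (F : numClosedFieldType) (m n : nat) : F :=
  - ((Mint m n - 4)%:~R / (4%:R * (Mint m n - 1)%:~R)).

(* Main.v *)
(* For (i) and (ii), write L_ab for the class of e_a (x) e_b - (-1)^[a][b] e_b (x) e_a.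
   The component X (.)_1 Y vanishes when X (x) Y is replaced by a tensor of the form
   q(U) or phi(S), so modulo J^1_lam the antisymmetrization over abc of L_ab L_cd and
   the contraction sum g_cd L_ac L_db - kappa g_ba - mu L_ab are of lower order, with
   mu = (M-2)/2 and kappa = 2 lam (M-1).  Multiplying the first relation on the right
   by L_de, contracting over d and using the second relation gives
   (kappa + mu - 1)(g_ec L_ab + cyclic) = 0, and one more contraction gives
   (M-2)(kappa + mu - 1) L_ab = 0; the factor kappa + mu - 1 vanishes exactly at the
   critical value of lam.

   For (iii), osp(m|2n) acts by L_ab = x_a d_b - (-1)^[a][b] x_b d_a on functions on
   C^{m|2n} and commutes with sl2 = <R^2, Laplacian, Euler>.  At the critical value the
   ideal acts by elements of R^2 A + A Laplacian + A (E - w) with w = 2 - M/2.  For null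
   orthogonal coordinates u, z the functions u^(w-j) z^j are harmonic of degree w, and
   the element u d_z - z' d_u' of osp(m|2n), with u', z' dual to u, z, maps
   u^(w-j) z^j to j u^(w-j+1) z^(j-1); evaluating where all coordinates
   other than u and z vanish kills the image of R^2, so the powers of this element are
   linearly independent modulo the ideal. *)
Require Import Defs.
From HB Require Import structures.
From mathcomp Require Import all_boot all_order all_algebra.
From mathcomp Require Import ring zify.
From mathcomp Require Import boolp functions.
Import Order.TTheory GRing.Theory Num.Theory.
Local Open Scope ring_scope.
Set Implicit Arguments. Unset Strict Implicit. Unset Printing Implicit Defensive.

(** Both directions turn on one number: [kappa + mu - 1 = 0] says [2 lam (M-1) = 2 - M/2 = w]. For
    the differential operators, the supersymmetrized contraction of [L] is [2 (x_a d_e + (-1)^[a][e]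
    x_e d_a) (E - w) + 2 g_ea E] up to terms [R^2 p] and [q Laplacian], so it takes the value
    [2 kappa g_ea] prescribed by the ideal when [E] acts by [w] and [w = kappa]. Three obstacles
    shape part (iii). The degree [w] may be negative or half an odd integer, so polynomials do not
    suffice and one variable gets exponents in [w + Z]. The metric is arbitrary, so null coordinates
    have to be produced; the convention [g^{ab} = g_{ab}] makes its even block a symmetric matrix of
    square one, for which square roots, and hence a congruence to any other such matrix, are
    explicit. Finally [R^2 A + A Laplacian + A (E - w)] is not an ideal of [A]; it is only stable
    under operators commuting with [sl2], which is enough because [osp] acts by such operators. *)

Section LinearReflection.
Variables (R : pzRingType) (V : lmodType R).

Inductive lexp :=
  | LVar of nat | LZero | LAdd of lexp & lexp | LOpp of lexp | LScale of R & lexp.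

Fixpoint leval (env : seq V) e : V :=
  match e with
  | LVar i => nth 0 env i
  | LZero => 0
  | LAdd e1 e2 => leval env e1 + leval env e2
  | LOpp e1 => - leval env e1
  | LScale c e1 => c *: leval env e1
  end.

Fixpoint lcoef e (i : nat) : R :=
  match e with
  | LVar j => if eqn i j then 1 else 0
  | LZero => 0
  | LAdd e1 e2 => lcoef e1 i + lcoef e2 i
  | LOpp e1 => - lcoef e1 i
  | LScale c e1 => c * lcoef e1 i
  end.

Lemma levalE env e : leval env e = \sum_(i < size env) lcoef e i *: nth 0 env i.
Proof.
elim: e => [j||e1 IH1 e2 IH2|e1 IH1|c e1 IH1] /=.
- case: (ltnP j (size env)) => hj; last first.
    rewrite nth_default // big1 // => i _.
    have -> : eqn i j = false by apply: (ltn_eqF (leq_trans (ltn_ord i) hj)).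
    exact: scale0r.
  rewrite (bigD1 (Ordinal hj)) //= -[eqn j j]/(j == j) eqxx scale1r big1 ?addr0 // => i.
  by rewrite -val_eqE /= -[eqn i j]/(val i == j) => /negbTE ->; rewrite scale0r.
- by rewrite big1 // => i _; rewrite scale0r.
- by rewrite IH1 IH2 -big_split; apply: eq_bigr => i _; rewrite /= scalerDl.
- by rewrite IH1 -sumrN; apply: eq_bigr => i _; rewrite /= scaleNr.
- by rewrite IH1 scaler_sumr; apply: eq_bigr => i _; rewrite /= scalerA.
Qed.

(** A conjunction in [Prop] instead of a boolean test: the coefficients lie in an abstract ring, so
    each equation is left as a goal for [ring] or [field]. *)
Fixpoint lcheck n e1 e2 : Prop :=
  if n is n'.+1 then lcoef e1 n' = lcoef e2 n' /\ lcheck n' e1 e2 else True.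

Lemma leval_eq env e1 e2 : lcheck (size env) e1 e2 -> leval env e1 = leval env e2.
Proof.
move=> h; rewrite !levalE; apply: eq_bigr => i _; congr (_ *: _).
have: (i < size env)%N by [].
move: (nat_of_ord i) => {i} j; elim: (size env) h => [|k IH] //= [h0 h1].
by rewrite ltnS leq_eqVlt => /predU1P[-> //|]; apply: IH.
Qed.
End LinearReflection.

(* Atoms are compared up to conversion: the same operation can occur through different structure instances. *)
Ltac lin_mem x l :=
  match l with
  | nil => constr:(false)
  | cons ?y _ => let _ := match goal with _ => unify x y end in constr:(true)
  | cons _ ?l' => lin_mem x l'
  end.
Ltac lin_add x l :=
  let b := lin_mem x l in
  lazymatch b with true => l | false => constr:(cons x l) end.
Ltac lin_atoms e l :=
  lazymatch e with
  | ?x + ?y => let l1 := lin_atoms x l in lin_atoms y l1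
  | - ?x => lin_atoms x l
  | ?c *: ?x => lin_atoms x l
  | 0 => l
  | _ => lin_add e l
  end.
Ltac lin_index x l :=
  match l with
  | cons ?y _ => let _ := match goal with _ => unify x y end in constr:(0%N)
  | cons _ ?l' => let n := lin_index x l' in constr:(n.+1)
  end.
Ltac lin_reify R e l :=
  lazymatch e with
  | ?x + ?y => let a := lin_reify R x l in let b := lin_reify R y l in constr:(LAdd a b)
  | - ?x => let a := lin_reify R x l in constr:(LOpp a)
  | ?c *: ?x => let a := lin_reify R x l in constr:(LScale c a)
  | 0 => constr:(LZero R)
  | _ => let n := lin_index e l in constr:(LVar R n)
  end.
(* Reduces an equation between linear combinations to the equations between the coefficients of each atom. *)
Ltac linear_coefs R :=
  lazymatch goal with
  | |- @eq ?T ?x ?y =>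
    let l0 := lin_atoms x (@nil T) in
    let l := lin_atoms y l0 in
    let a := lin_reify R x l in
    let b := lin_reify R y l in
    apply: (leval_eq (env := l) (e1 := a) (e2 := b)); cbn [lcheck lcoef size eqn]; repeat split
  end.

(** * Tensors and the maps q and phi *)

Ltac parity_cases :=
  repeat match goal with |- context [par ?a] => case: (par a) end;
  rewrite /sgn /=.

Section Metric.
Variables (F : numClosedFieldType) (m n : nat).
Local Notation I := 'I_(m + n.*2).
Variable g : I -> I -> F.
Hypothesis hg : is_osp_metric g.

Definition sg (a b : I) : F := sgn F (par a && par b).
Definition sdim : F := \sum_(a : I) sgn F (par a).

Lemma sum_delta (V : lmodType F) (b : I) (f : I -> V) :
  \sum_c (b == c)%:R *: f c = f b.
Proof.
rewrite (bigD1 b) //= eqxx scale1r big1 ?addr0 // => c.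
by rewrite eq_sym => /negbTE ->; rewrite scale0r.
Qed.

Lemma sum_deltaF (b : I) (f : I -> F) : \sum_c (b == c)%:R * f c = f b.
Proof. exact: (@sum_delta F^o). Qed.

Lemma metric_par a b : par a != par b -> g a b = 0.
Proof. by have [h _ _] := hg; apply: h. Qed.

Lemma metricC a b : g b a = sg a b * g a b.
Proof. by have [_ h _] := hg; apply: h. Qed.

(** Next to a factor [g a b] the two indices may be assumed of equal parity. Many sign identities
    under a contraction hold only with this assumption. *)
Lemma metric_congr a b (x y : F) :
  (par a = par b -> x = y) -> g a b * x = g a b * y.
Proof.
move=> h; case: (eqVneq (par a) (par b)) => [/h->//|ne].
by rewrite metric_par ?mul0r.
Qed.

Lemma metricZ_congr (V : lmodType F) a b (x y : V) :
  (par a = par b -> x = y) -> g a b *: x = g a b *: y.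
Proof.
move=> h; case: (eqVneq (par a) (par b)) => [/h->//|ne].
by rewrite metric_par ?scale0r.
Qed.

Lemma metricK b c : \sum_a g a c * g a b = (b == c)%:R.
Proof. by have [_ _ h] := hg; apply: h. Qed.

Lemma metricKr b c : \sum_a g c a * g b a = (b == c)%:R.
Proof.
pose G : 'M[F]_(m + n.*2) := \matrix_(i, j) g i j.
have h : G^T *m G = 1%:M.
  apply/matrixP => i j; rewrite !mxE -metricK.
  by apply: eq_bigr => a _; rewrite !mxE mulrC.
have /matrixP/(_ c b) := mulmx1C h; rewrite !mxE eq_sym => <-.
by apply: eq_bigr => a _; rewrite !mxE.
Qed.

(** Contracting a second with a first index transposes one of the metrics, at the cost of
    [(-1)^[b]]; this is why the full contraction of [g] is the superdimension [M]. *)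
Lemma metric_mid b c : \sum_a g c a * g a b = sgn F (par b) * (b == c)%:R.
Proof.
rewrite -(metricKr b c) mulr_sumr; apply: eq_bigr => a _.
rewrite (metricC b a) mulrCA [RHS]mulrCA [in RHS](mulrC _ (g b a)).
rewrite [in LHS](mulrC (sg b a)) -!mulrA; congr (_ * _).
by apply: metric_congr => h; rewrite /sg -h; case: (par b).
Qed.

Lemma metric_trace : \sum_b \sum_c g b c * g c b = sdim.
Proof.
rewrite exchange_big; apply: eq_bigr => c _.
under eq_bigr do rewrite mulrC.
by rewrite metric_mid eqxx mulr1.
Qed.

Definition tr2 (X : I -> I -> F) : F := \sum_b \sum_c g b c * X c b.
Definition tr4 (V : I -> I -> I -> I -> F) (a d : I) : F :=
  \sum_b \sum_c g b c * V a c b d.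

Definition alt4 (Q : I -> I -> I -> I -> F) : Prop :=
  [/\ forall a b c d, Q a b c d = - (sg a b * Q b a c d),
      forall a b c d, Q a b c d = - (sg b c * Q a c b d)
    & forall a b c d, Q a b c d = - (sg c d * Q a b d c)].

(** On supersymmetric tensors [q] is the full antisymmetrization: the eight symmetries already
    present reduce the 24 permutations to three terms. *)
Lemma alt4_q W : sym_gg W -> alt4 (qmap W).
Proof.
case=> -[h1 h2] h3; split=> a b c d; rewrite /qmap.
- by rewrite (h1 b a c d) /sg; parity_cases; ring.
- by rewrite (h1 c b a d) /sg; parity_cases; ring.
- by rewrite (h2 a b d c) (h3 b d a c) (h3 a d b c) /sg; parity_cases; ring.
Qed.

Lemma alt4_sym Q : alt4 Q -> sym_gg Q.
Proof.
case=> h1 h2 h3; split; first by split=> a b c d; [apply: h1 | apply: h3].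
move=> a b c d.
rewrite (h2 a b c d) (h1 a c b d) (h3 c a b d) (h2 c a d b) /sg.
by parity_cases; ring.
Qed.

Lemma sym_tr4 Q : sym_gg Q -> sym2 (tr4 Q).
Proof.
case=> -[h1 h2] h3 a d; rewrite /tr4 exchange_big mulr_sumr /=.
apply: eq_bigr => c _; rewrite mulr_sumr; apply: eq_bigr => b _.
rewrite metricC -mulrA mulrCA [RHS]mulrCA; apply: metric_congr => e.
rewrite (h3 a c b d) (h1 b d a c) (h2 d b a c) /sg e.
by parity_cases; ring.
Qed.

(** The metric is supersymmetric and [Q] super-antisymmetric in the contracted pair, so the trace
    equals its negative. *)
Lemma alt4_tr Q : alt4 Q -> forall a d, tr4 Q a d = 0.
Proof.
case=> _ h2 _ a d.
suff e : tr4 Q a d = - tr4 Q a d.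
  by apply/eqP; rewrite -[_ == 0](mulrn_eq0 _ 2) mulr2n {1}e addNr.
rewrite {1}/tr4 exchange_big /= /tr4 -sumrN; apply: eq_bigr => c _.
rewrite -sumrN; apply: eq_bigr => b _.
rewrite metricC h2 -mulrA mulrCA -[in RHS]mulrN; apply: metric_congr => e.
by rewrite /sg e; parity_cases; ring.
Qed.

Lemma alt4_qid Q : alt4 Q -> forall a b c d, qmap Q a b c d = Q a b c d.
Proof.
case=> h1 h2 h3 a b c d; rewrite /qmap (h1 b c a d) (h2 c b a d) (h1 c a b d) (h2 a c b d) /sg.
by parity_cases; field.
Qed.

Lemma sum_metric_r (a : I) (f : I -> F) :
  \sum_b \sum_c g a b * (g b c * (sg a c * f c)) = f a.
Proof.
rewrite exchange_big /= -[RHS](sum_deltaF a); apply: eq_bigr => c _.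
under eq_bigr do rewrite mulrA.
rewrite -mulr_suml metric_mid eq_sym; case: eqP => [->|_]; last by rewrite mulr0 !mul0r.
by rewrite /sg; parity_cases; ring.
Qed.

(** The four terms of [phi] contribute [M X], [- X], [- X] and [g tr(X)]. This is the source of the
    factor [M - 2] and, after a second trace, of [M - 1]. *)
Lemma tr4_phi X a d :
  tr4 (phimap g X) a d = 4^-1 * ((sdim - 2) * X a d + g a d * tr2 X).
Proof.
have e1 : \sum_b \sum_c g b c * (g c b * X a d) = sdim * X a d.
  rewrite -metric_trace mulr_suml; apply: eq_bigr => b _.
  by rewrite mulr_suml; apply: eq_bigr => c _; rewrite mulrA.
have e2 : \sum_b \sum_c g b c * (sg a c * (g a b * X c d)) = X a d.
  rewrite -(sum_metric_r a (X^~ d)); apply: eq_bigr => b _.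
  by apply: eq_bigr => c _; ring.
have e3 : \sum_b \sum_c g b c * (sg b d * (g c d * X a b)) = X a d.
  rewrite -[RHS](sum_deltaF d); apply: eq_bigr => b _.
  transitivity (\sum_c (g b c * g c d) * (sg b d * X a b)).
    by apply: eq_bigr => c _; ring.
  rewrite -mulr_suml metric_mid; case: eqP => [->|_]; last by rewrite mulr0 !mul0r.
  by rewrite /sg; parity_cases; ring.
have e4 : \sum_b \sum_c g b c * (sgn F ((par a && par c) (+) (par b && par d)) * (g a d * X c b)) = g a d * tr2 X.
  rewrite /tr2 mulr_sumr; apply: eq_bigr => b _; rewrite mulr_sumr.
  apply: eq_bigr => c _; rewrite [RHS]mulrCA; apply: metric_congr => h.
  rewrite [LHS]mulrCA; apply: metric_congr => h'; rewrite h h'.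
  by parity_cases; ring.
rewrite (_ : (sdim - 2) * X a d + g a d * tr2 X
   = sdim * X a d - X a d - X a d + g a d * tr2 X); last by ring.
rewrite -e4 -[in X in _ - X + _]e3 -[in X in _ - X - _]e2 -e1.
rewrite -!sumrB -big_split mulr_sumr /=; apply: eq_bigr => b _.
rewrite -!sumrB -big_split mulr_sumr /=; apply: eq_bigr => c _.
by rewrite /phimap /sg; ring.
Qed.

Lemma tr2_metric : tr2 g = sdim.
Proof. exact: metric_trace. Qed.

Lemma tr2_lin (c : F) X Y : tr2 (fun a b => c * X a b + Y a b) = c * tr2 X + tr2 Y.
Proof.
rewrite /tr2 mulr_sumr -big_split; apply: eq_bigr => b _.
rewrite mulr_sumr -big_split; apply: eq_bigr => e _ /=; ring.
Qed.

Lemma sym_phi S : sym2 S -> sym_gg (phimap g S).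
Proof.
move=> h; split; [split|]; move=> a b c d; rewrite /phimap.
- by parity_cases; ring.
- by parity_cases; ring.
rewrite (metricC b c) (metricC a c) (metricC b d) (metricC a d).
rewrite (h d a) (h d b) (h c a) (h c b) /sg.
(* The signs match only for entries of [g] between indices of equal parity; the other entries are
   zero and are rewritten away in each parity case. *)
move: (@metric_par a c) (@metric_par a d) (@metric_par b c) (@metric_par b d).
by parity_cases; move=> p1 p2 p3 p4; try rewrite (p1 isT); try rewrite (p2 isT);
  try rewrite (p3 isT); try rewrite (p4 isT); ring.
Qed.

Lemma q_phi S : sym2 S -> forall a b c d, qmap (phimap g S) a b c d = 0.
Proof.
move=> h a b c d; rewrite /qmap /phimap.
rewrite (metricC b c) (metricC a c) (metricC a b) (h c a) (h c b) (h b a).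
move: (@metric_par a c) (@metric_par a d) (@metric_par b c) (@metric_par b d).
move: (@metric_par a b) (@metric_par c d); rewrite /sg.
by parity_cases; move=> p1 p2 p3 p4 p5 p6; try rewrite (p1 isT); try rewrite (p2 isT);
  try rewrite (p3 isT); try rewrite (p4 isT);
  try rewrite (p5 isT); try rewrite (p6 isT); ring.
Qed.

End Metric.

(** * The component in the first Cartan product *)

Section Projection.
Variables (F : numClosedFieldType) (m n : nat).
Local Notation I := 'I_(m + n.*2).
Local Notation tensor4 := (I -> I -> I -> I -> F).
Variable g : I -> I -> F.
Hypothesis hg : is_osp_metric g.
Local Notation M := (sdim F m n).

Definition swap4 (T : tensor4) : tensor4 := fun a b c d =>
  sgn F ((par a (+) par b) && (par c (+) par d)) * T c d a b.
Definition symm4 (T : tensor4) : tensor4 := fun a b c d =>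
  2^-1 * (T a b c d + swap4 T a b c d).
(** The solution [S] of [tr4 (phi S) = tr4 W]: the double trace gives [(M-1)/2] times the trace of
    [S], and then [tr4_phi] gives [(M-2)/4] times [S]. The divisions are the reason for excluding
    [M = 1] and [M = 2]. *)
Definition trace_part (W : tensor4) (a d : I) : F :=
  4 / (M - 2) * (tr4 g W a d - g a d * tr2 g (tr4 g W) / (2 * (M - 1))).
(** The two corrections do not interfere, since [q] vanishes on the image of [phi] and the trace
    vanishes on the image of [q]. *)
Definition proj4 (T : tensor4) : tensor4 := fun a b c d =>
  symm4 T a b c d - qmap (symm4 T) a b c d - phimap g (trace_part (symm4 T)) a b c d.

Lemma tr4_lin (c : F) (V W : tensor4) a d :
  tr4 g (fun i j k l => c * V i j k l + W i j k l) a d = c * tr4 g V a d + tr4 g W a d.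
Proof.
rewrite /tr4 mulr_sumr -big_split; apply: eq_bigr => b _.
rewrite mulr_sumr -big_split; apply: eq_bigr => e _ /=; ring.
Qed.

Lemma tr2Z (c : F) X : tr2 g (fun a b => c * X a b) = c * tr2 g X.
Proof.
by rewrite /tr2 mulr_sumr; apply: eq_bigr => b _; rewrite mulr_sumr;
  apply: eq_bigr => e _; ring.
Qed.

Lemma tr2_tr4_phi X : tr2 g (tr4 g (phimap g X)) = (M - 1) / 2 * tr2 g X.
Proof.
have -> : tr4 g (phimap g X) = fun a d =>
    (4^-1 * (M - 2)) * X a d + (4^-1 * tr2 g X) * g a d.
  by apply/funext => a; apply/funext => d; rewrite tr4_phi //; ring.
by rewrite tr2_lin tr2Z tr2_metric //; field.
Qed.

Lemma sym_gg_lin (c : F) (V W : tensor4) : sym_gg V -> sym_gg W ->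
  sym_gg (fun i j k l => c * V i j k l + W i j k l).
Proof.
move=> [[v1 v2] v3] [[w1 w2] w3]; split; [split|]; move=> i j k l.
- by rewrite (v1 i) (w1 i); ring.
- by rewrite (v2 i) (w2 i); ring.
- by rewrite (v3 i) (w3 i); ring.
Qed.

Lemma qmap_lin (c : F) (V W : tensor4) i j k l :
  qmap (fun i j k l => c * V i j k l + W i j k l) i j k l = c * qmap V i j k l + qmap W i j k l.
Proof. by rewrite /qmap; ring. Qed.

Lemma symm4_sym (T : tensor4) : in_gg T -> sym_gg (symm4 T).
Proof.
move=> [t1 t2]; split; [split|]; move=> a b c d; rewrite /symm4 /swap4.
- by rewrite (t1 b a) (t2 c d b a); parity_cases; ring.
- by rewrite (t2 a b d c) (t1 d c); parity_cases; ring.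
- by parity_cases; ring.
Qed.

Lemma symm4_id (W : tensor4) : sym_gg W -> symm4 W = W.
Proof.
case=> _ h; do 4![apply/funext => ?].
by rewrite /symm4 /swap4 -h; field.
Qed.

Lemma sym2_trace_part W : sym_gg W -> sym2 (trace_part W).
Proof.
move=> /(sym_tr4 hg) h a d; rewrite /trace_part h (metricC hg d a) /sg.
by move: (par a && par d) (par d && par a) (andbC (par a) (par d)) => b _ <-; case: b;
  rewrite /sgn; ring.
Qed.

Hypotheses (hM1 : M != 1) (hM2 : M != 2).

Let hM1' : M - 1 != 0. Proof. by rewrite subr_eq0. Qed.
Let hM2' : M - 2 != 0. Proof. by rewrite subr_eq0. Qed.

Lemma trace_part_phi S : trace_part (phimap g S) = S.
Proof.
apply/funext => a; apply/funext => d; rewrite /trace_part tr2_tr4_phi tr4_phi //.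
by field; rewrite hM1'.
Qed.

Lemma proj4_cartan T : in_gg T -> cartan1 g (proj4 T).
Proof.
move=> /symm4_sym; rewrite /proj4; set W := symm4 T => hW.
have hQ := alt4_q hW.
have hS := sym2_trace_part hW.
have e : (fun a b c d => W a b c d - qmap W a b c d - phimap g (trace_part W) a b c d) =
  fun a b c d => (-1) * phimap g (trace_part W) a b c d + ((-1) * qmap W a b c d + W a b c d).
  by do 4![apply/funext => ?]; ring.
rewrite e; split.
- apply: sym_gg_lin; first exact: (sym_phi hg).
  by apply: sym_gg_lin => //; apply: alt4_sym.
- move=> a d.
  change (tr4 g (fun a b c d => (-1) * phimap g (trace_part W) a b c d +
    ((-1) * qmap W a b c d + W a b c d)) a d = 0).
  rewrite !tr4_lin (alt4_tr hg hQ) tr4_phi //.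
  have -> : tr2 g (trace_part W) = 2 * tr2 g (tr4 g W) / (M - 1).
    have -> : trace_part W = fun a d => (- 4 / (M - 2) * (tr2 g (tr4 g W) / (2 * (M - 1)))) * g a d + 4 / (M - 2) * tr4 g W a d.
      by do 2![apply/funext => ?]; rewrite /trace_part; ring.
    by rewrite tr2_lin tr2Z tr2_metric //; field; rewrite hM1'.
  by rewrite /trace_part; field; rewrite hM1'.
- move=> a b c d; rewrite !qmap_lin (alt4_qid hQ) (q_phi hg hS); ring.
Qed.

Lemma proj4_complement T : in_gg T ->
  cartan1_complement g (fun a b c d => T a b c d - proj4 T a b c d).
Proof.
move=> hT; have hW := symm4_sym hT.
exists (symm4 T), (trace_part (symm4 T)), (fun a b c d => T a b c d - symm4 T a b c d).
split=> //; first exact: sym2_trace_part.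
  case: hW => -[h1 h2] h3; case: hT => t1 t2; split; [split|]; move=> a b c d.
  - by rewrite t1 h1; ring.
  - by rewrite t2 h2; ring.
  - by rewrite /symm4 /swap4; parity_cases; field.
by move=> a b c d; rewrite /proj4; ring.
Qed.

(** On such tensors the Joseph relation loses its Cartan component. Together with [proj4_phi] this
    provides the two families of relations from which the collapse is derived. *)
Lemma proj4_q W : sym_gg W -> (forall a b c d, qmap W a b c d = W a b c d) ->
  forall a b c d, proj4 W a b c d = 0.
Proof.
move=> hW hq a b c d; rewrite /proj4 (symm4_id hW) hq subrr sub0r.
have t0 i j : tr4 g W i j = 0.
  rewrite -(alt4_tr hg (alt4_q hW) i j); congr tr4.
  by do 4![apply/funext => ?]; rewrite hq.
have -> : trace_part W = fun _ _ => 0.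
  do 2![apply/funext => ?]; rewrite /trace_part t0 /tr2 big1 ?mulr0 ?mul0r ?subr0 ?mulr0 //.
  by move=> i _; rewrite big1 // => j _; rewrite t0 mulr0.
by rewrite /phimap; ring.
Qed.

Lemma proj4_phi S : sym2 S -> forall a b c d, proj4 (phimap g S) a b c d = 0.
Proof.
move=> hS a b c d.
by rewrite /proj4 (symm4_id (sym_phi hg hS)) q_phi // trace_part_phi; ring.
Qed.

Lemma proj4_lin (c : F) (T U : tensor4) a b e d :
  proj4 (fun i j k l => c * T i j k l + U i j k l) a b e d = c * proj4 T a b e d + proj4 U a b e d.
Proof.
have es : symm4 (fun i j k l => c * T i j k l + U i j k l) =
   fun i j k l => c * symm4 T i j k l + symm4 U i j k l.
  by do 4![apply/funext => ?]; rewrite /symm4 /swap4; ring.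
have et : trace_part (fun i j k l => c * symm4 T i j k l + symm4 U i j k l) =
   fun i j => c * trace_part (symm4 T) i j + trace_part (symm4 U) i j.
  do 2![apply/funext => ?]; rewrite /trace_part.
  have -> : tr4 g (fun i j k l => c * symm4 T i j k l + symm4 U i j k l) =
    fun i j => c * tr4 g (symm4 T) i j + tr4 g (symm4 U) i j.
    by do 2![apply/funext => ?]; rewrite tr4_lin.
  by rewrite tr2_lin; field; rewrite hM1'.
by rewrite /proj4 es et /qmap /phimap; ring.
Qed.

(** As a double trace, the invariant form is linear in the tensor of [X] and [Y]; the Joseph
    relation can then be extended beyond pure tensors. *)
Lemma form_tr (X Y : I -> I -> F) : Defs.form g X Y = tr2 g (tr4 g (fun a b c d => X a b * Y c d)).
Proof.
rewrite /Defs.form /lower2 /tr2 /tr4; apply: eq_bigr => a _.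
transitivity (\sum_c \sum_b \sum_d g a c * g b d * X c d * Y b a).
  under eq_bigr => b _ do rewrite mulr_suml.
  rewrite exchange_big; apply: eq_bigr => c _; apply: eq_bigr => b _.
  by rewrite mulr_suml.
apply: eq_bigr => c _; rewrite mulr_sumr; apply: eq_bigr => b _; rewrite mulr_sumr.
by apply: eq_bigr => d _; ring.
Qed.

(** This is the supersymmetry of the invariant form: exchanging the indices within both contracted
    pairs turns [Z] into its negative. *)
Lemma tr_asym (Z : tensor4) : asym_gg Z -> tr2 g (tr4 g Z) = 0.
Proof.
case=> [[h1 h2] h3].
suff e : tr2 g (tr4 g Z) = - tr2 g (tr4 g Z).
  by apply/eqP; rewrite -[_ == 0](mulrn_eq0 _ 2) mulr2n {1}e addNr.
rewrite {1}/tr2 exchange_big /= /tr2 -sumrN; apply: eq_bigr => c _.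
rewrite -sumrN; apply: eq_bigr => b _.
rewrite (metricC hg c b) -mulrA mulrCA -mulrN; apply: (metric_congr hg) => h.
rewrite /tr4 exchange_big mulr_sumr -sumrN; apply: eq_bigr => d _.
rewrite mulr_sumr -sumrN; apply: eq_bigr => e _.
rewrite (metricC hg d e); transitivity (g d e * (sg F c b * sg F d e * Z c d e b)); first by ring.
rewrite -mulrN; apply: (metric_congr hg) => h'.
rewrite h3 (h1 e b) (h2 _ _ c d) /sg h h'.
by parity_cases; ring.
Qed.
End Projection.

(** * The tensor algebra *)

Section TensorAlgebra.
Variables (F : numClosedFieldType) (m n : nat).
Local Notation I := 'I_(m + n.*2).

Definition talg : Type := seq I -> F^o.
HB.instance Definition _ := GRing.Lmodule.copy talg (seq I -> F^o).

Definition tmulr (t u : talg) : talg := @tmul F m n t u.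

Lemma tmulr_nil (t u : talg) : tmulr t u [::] = t [::] * u [::].
Proof. by rewrite /tmulr /tmul big_ord1. Qed.

(** Peeling off the first letter gives a recursion on words, by which associativity is proved
    without manipulating cut positions. *)
Lemma tmulr_cons (t u : talg) a s :
  tmulr t u (a :: s) = t [::] * u (a :: s) + tmulr (fun r => t (a :: r)) u s.
Proof. by rewrite /tmulr /tmul big_ord_recl. Qed.

Lemma tmulrDl (t u v : talg) : tmulr (t + u) v = tmulr t v + tmulr u v.
Proof.
apply/funext => s; rewrite /tmulr /tmul -[RHS]big_split; apply: eq_bigr => i _ /=.
exact: mulrDl.
Qed.

Lemma tmulrDr (t u v : talg) : tmulr t (u + v) = tmulr t u + tmulr t v.
Proof.
apply/funext => s; rewrite /tmulr /tmul -[RHS]big_split; apply: eq_bigr => i _ /=.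
exact: mulrDr.
Qed.

Lemma tmulrZl (c : F) (t u : talg) : c *: tmulr t u = tmulr (c *: t) u.
Proof.
apply/funext => s; rewrite /tmulr /tmul.
rewrite -[LHS]/(c * (\sum_(i < (size s).+1) t (take i s) * u (drop i s))) mulr_sumr.
apply: eq_bigr => i _ /=; exact: mulrA.
Qed.

Lemma tmulrZr (c : F) (t u : talg) : c *: tmulr t u = tmulr t (c *: u).
Proof.
apply/funext => s; rewrite /tmulr /tmul.
rewrite -[LHS]/(c * (\sum_(i < (size s).+1) t (take i s) * u (drop i s))) mulr_sumr.
apply: eq_bigr => i _ /=; exact: mulrCA.
Qed.

Lemma tmulrA : associative tmulr.
Proof.
move=> t u v; apply/funext => s; elim: s t u v => [|a s IH] t u v.
  by rewrite !tmulr_nil mulrA.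
rewrite !tmulr_cons tmulr_nil.
have -> : (fun r => tmulr t u (a :: r)) =
    t [::] *: ((fun r => u (a :: r)) : talg) + tmulr (fun r => t (a :: r)) u.
  by apply/funext => r; rewrite tmulr_cons.
rewrite tmulrDl -tmulrZl IH.
by rewrite -[RHS]/(_ + (t [::] * _ + _)) mulrDr mulrA -addrA.
Qed.

Lemma tmulr1l : left_id (@tone F m n : talg) tmulr.
Proof.
move=> t; apply/funext => -[|a s]; first by rewrite tmulr_nil mul1r.
rewrite tmulr_cons mul1r /tmulr /tmul big1 ?addr0 // => i _.
by rewrite /= mul0r.
Qed.

Lemma tmulr1r : right_id (@tone F m n : talg) tmulr.
Proof.
move=> t; apply/funext => s; elim: s t => [|a s IH] t; first by rewrite tmulr_nil mulr1.
by rewrite tmulr_cons IH /= mulr0 add0r.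
Qed.

Lemma tone_neq0 : (@tone F m n : talg) != 0.
Proof.
apply/eqP => /(congr1 (fun t : talg => t [::])) /eqP; rewrite /=.
exact/negP/oner_neq0.
Qed.

HB.instance Definition _ := GRing.Zmodule_isNzRing.Build talg
  tmulrA tmulr1l tmulr1r tmulrDl tmulrDr tone_neq0.
HB.instance Definition _ := GRing.Lmodule_isLalgebra.Build F talg tmulrZl.
HB.instance Definition _ := GRing.Lalgebra_isAlgebra.Build F talg tmulrZr.

Lemma talgM (t u : talg) : t * u = @tmul F m n t u. Proof. by []. Qed.
Lemma talg_sum (J : Type) (r : seq J) P (f : J -> talg) s :
  (\sum_(i <- r | P i) f i) s = \sum_(i <- r | P i) (f i s : F).
Proof. by elim/big_rec2: _ => // i x y _ <-. Qed.

(* A named unit, so that its occurrences at different instances of the algebra structure stay syntactically equal. *)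
Definition tunit : talg := 1.

Definition e2 (X : I -> I -> F) : talg := @emb2 F m n X.
Definition e4 (X : I -> I -> I -> I -> F) : talg := @emb4 F m n X.

Lemma e2M X Y : e2 X * e2 Y = e4 (fun a b c d => X a b * Y c d).
Proof.
apply/funext => s; rewrite talgM /tmul.
case: s => [|a [|b [|c [|d [|e s]]]]];
  rewrite !big_ord_recl ?big_ord0 /= /e2 /e4 /emb2 /= ?mul0r ?mulr0 ?add0r ?addr0 //.
by rewrite big1 // => i _; rewrite /= mul0r.
Qed.

Lemma e2_lin c X Y : e2 (fun a b => c * X a b + Y a b) = c *: e2 X + e2 Y.
Proof.
apply/funext => -[|a [|b [|d s]]] //=; rewrite /e2 /=.
- by rewrite -[RHS]/(c * 0 + 0) mulr0 addr0.
- by rewrite -[RHS]/(c * 0 + 0) mulr0 addr0.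
- by rewrite -[RHS]/(c * 0 + 0) mulr0 addr0.
Qed.

Lemma e4_lin c X Y :
  e4 (fun i j k l => c * X i j k l + Y i j k l) = c *: e4 X + e4 Y.
Proof.
apply/funext => -[|a [|b [|d [|e [|x s]]]]] //=; rewrite /e4 /=;
 by rewrite -[RHS]/(c * 0 + 0) mulr0 addr0.
Qed.
End TensorAlgebra.

(** * Quadratic expressions in an abstract family [L], shared by the tensors [Lt] and the
    differential operators *)

Section Generators.
Variables (F : numClosedFieldType) (m n : nat).
Local Notation I := 'I_(m + n.*2).
Variable g : I -> I -> F.
Hypothesis hg : is_osp_metric g.
Variables (A : algType F) (L : I -> I -> A).
Hypothesis LC : forall a b, L a b = - (sg F a b *: L b a).
Local Notation s := (sg F).

Definition sum4 (f : I -> I -> I -> I -> A) : A :=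
  \sum_a \sum_b \sum_c \sum_d f a b c d.

Lemma eq_sum4 f h : (forall a b c d, f a b c d = h a b c d) -> sum4 f = sum4 h.
Proof. by move=> e; do 4![apply: eq_bigr => ? _]. Qed.

Lemma sum4D f h : sum4 (fun a b c d => f a b c d + h a b c d) = sum4 f + sum4 h.
Proof.
rewrite /sum4 -big_split; apply: eq_bigr => a _; rewrite -big_split.
apply: eq_bigr => b _; rewrite -big_split; apply: eq_bigr => c _.
by rewrite -big_split.
Qed.

Lemma sum4Z k f : sum4 (fun a b c d => k *: f a b c d) = k *: sum4 f.
Proof.
rewrite /sum4 scaler_sumr; apply: eq_bigr => a _; rewrite scaler_sumr.
apply: eq_bigr => b _; rewrite scaler_sumr; apply: eq_bigr => c _.
by rewrite scaler_sumr.
Qed.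

Lemma sum4_swap12 f : sum4 f = sum4 (fun a b c d => f b a c d).
Proof. exact: exchange_big. Qed.
Lemma sum4_swap23 f : sum4 f = sum4 (fun a b c d => f a c b d).
Proof. by apply: eq_bigr => a _; exact: exchange_big. Qed.
Lemma sum4_swap34 f : sum4 f = sum4 (fun a b c d => f a b d c).
Proof. by do 2![apply: eq_bigr => ? _]; exact: exchange_big. Qed.

(** The image of [T] when the generator of index [(a, b)] is sent to [L a b]; the factor 1/4
    compensates for counting each antisymmetric pair twice. *)
Definition op4 (T : I -> I -> I -> I -> F) : A :=
  4^-1 *: sum4 (fun a b c d => T a b c d *: (L a b * L c d)).
(** The structure constants of [osp]: the value that the supercommutator of [L a b] and [L c d] must
    have. *)
Definition comm4 (a b c d : I) : A :=
  g c b *: L a d - (s a b * g c a) *: L b d - (s c d * g d b) *: L a c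
  + (s a b * s c d * g d a) *: L b c.
Definition Lsq (a d : I) : A := \sum_b \sum_c g b c *: (L a b * L c d).

Lemma sgK (a b : I) : s a b * s a b = 1.
Proof. by rewrite /sg; parity_cases; ring. Qed.

(** Super-antisymmetry of [L] in each factor moves the metric of every term of [phi] onto the inner
    indices, so the four terms agree. *)
Lemma op4_phi X :
  op4 (phimap g X) = 4^-1 *: \sum_a \sum_d X a d *: Lsq a d.
Proof.
pose S := sum4 (fun a b c d => (g b c * X a d) *: (L a b * L c d)).
have eS : S = \sum_a \sum_d X a d *: Lsq a d.
  rewrite /S sum4_swap34 sum4_swap23; apply: eq_bigr => a _; apply: eq_bigr => d _.
  rewrite scaler_sumr; apply: eq_bigr => b _; rewrite scaler_sumr.
  by apply: eq_bigr => c _; rewrite scalerA mulrC.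
have e2 : sum4 (fun a b c d => (s a b * (g a c * X b d)) *: (L a b * L c d)) = - S.
  rewrite sum4_swap12 -scaleN1r -sum4Z; apply: eq_sum4 => a b c d.
  rewrite (LC b a) mulNr -scalerAl !scalerN !scalerA -scaleNr; congr (_ *: _).
  by rewrite /sg andbC; parity_cases; ring.
have e3 : sum4 (fun a b c d => (s c d * (g b d * X a c)) *: (L a b * L c d)) = - S.
  rewrite sum4_swap34 -scaleN1r -sum4Z; apply: eq_sum4 => a b c d.
  rewrite (LC d c) mulrN -scalerAr !scalerN !scalerA -scaleNr; congr (_ *: _).
  by rewrite /sg andbC; parity_cases; ring.
have e4 : sum4 (fun a b c d => (s a b * s c d * (g a d * X b c)) *: (L a b * L c d)) = S.
  rewrite sum4_swap12 sum4_swap34; apply: eq_sum4 => a b c d.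
  rewrite (LC b a) (LC d c) mulNr mulrN opprK -scalerAl -scalerAr !scalerA; congr (_ *: _).
  by rewrite /sg; parity_cases; ring.
rewrite /op4 -eS; congr (_ *: _).
pose Sa (f : I -> I -> I -> I -> F) := sum4 (fun a b c d => f a b c d *: (L a b * L c d)).
transitivity (4^-1 *: (S + (-1) *: Sa (fun a b c d => s a b * (g a c * X b d))
  + (-1) *: Sa (fun a b c d => s c d * (g b d * X a c))
  + Sa (fun a b c d => s a b * s c d * (g a d * X b c)))).
  rewrite /S /Sa -!sum4Z -!sum4D -!sum4Z; apply: eq_sum4 => a b c d.
  rewrite !scalerA -!scalerDl scalerA; congr (_ *: _).
  by rewrite /phimap /sg; parity_cases; ring.
rewrite /Sa e2 e3 e4.
by move: (S) => x; linear_coefs (F : pzRingType); field.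
Qed.

(** The transposed contraction is written with its two factors in the opposite order, the form in
    which it appears in a contracted supercommutator. *)
Lemma Lsq_swap a b : s a b *: Lsq b a =
  \sum_c \sum_d g c d *: (sgn F ((par a (+) par c) && (par d (+) par b)) *: (L d b * L a c)).
Proof.
rewrite /Lsq exchange_big scaler_sumr; apply: eq_bigr => c _ /=.
rewrite scaler_sumr; apply: eq_bigr => d _.
rewrite (LC b d) (LC c a) mulNr mulrN opprK -scalerAl -scalerAr (metricC hg c d) !scalerA.
rewrite (_ : _ * s c a = g c d * (s a b * s c d * s b d * s c a)); last by ring.
rewrite -[LHS]scalerA -[RHS]scalerA; apply: (metricZ_congr hg) => e; congr (_ *: _).
by rewrite /sg e; parity_cases; ring.
Qed.
End Generators.

(** * Generators and relations modulo the ideal *)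

Section Basis.
Variables (F : numClosedFieldType) (m n : nat).
Local Notation I := 'I_(m + n.*2).
Local Notation tensor4 := (I -> I -> I -> I -> F).
Variable g : I -> I -> F.
Hypothesis hg : is_osp_metric g.
Local Notation s := (sg F).

(** A spanning family of [g] and not a basis: [(a, b)] and [(b, a)] give the same element up to
    sign, hence the factors 2 and 4 in sums over all indices. *)
Definition gbasis (a b : I) : I -> I -> F := fun i j =>
  (a == i)%:R * (b == j)%:R - s a b * ((b == i)%:R * (a == j)%:R).

Lemma gbasis_in a b : in_g (gbasis a b).
Proof.
move=> i j; rewrite /gbasis /sg -!natrM !mulnb (andbC (a == j)) (andbC (b == j)).
case: (boolP ((a == i) && (b == j))) => [/andP[/eqP ei /eqP ej]|_];
case: (boolP ((b == i) && (a == j))) => [/andP[/eqP ei' /eqP ej']|_]; subst => //;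
  by parity_cases; ring.
Qed.

Lemma gbasis_homog a b : homog (par a (+) par b) (gbasis a b).
Proof.
move=> i j h; apply/eqP; apply: contraR h => ne.
rewrite /gbasis -!natrM !mulnb.
case: (boolP ((a == i) && (b == j))) ne => [/andP[/eqP-> /eqP->]|_]; first by rewrite eqxx.
case: (boolP ((b == i) && (a == j))) => [/andP[/eqP-> /eqP->]|_ _].
  by rewrite addbC eqxx.
by rewrite mulr0 subr0 eqxx.
Qed.

Lemma gbasisC a b i j : gbasis a b i j = - (s a b * gbasis b a i j).
Proof.
rewrite /gbasis (_ : s b a = s a b) ?mulrBr ?mulrA ?sgK; last by rewrite /sg andbC.
by ring.
Qed.

Lemma gbasis_sum (X : I -> I -> F) i j : in_g X ->
  \sum_a \sum_b X a b * gbasis a b i j = 2 * X i j.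
Proof.
move=> hX; transitivity (\sum_a \sum_b ((i == a)%:R * ((j == b)%:R * X a b)
   - (j == a)%:R * ((i == b)%:R * (s a b * X a b)))).
  by apply: eq_bigr => a _; apply: eq_bigr => b _; rewrite /gbasis !(eq_sym i) !(eq_sym j); ring.
under eq_bigr => a _ do rewrite sumrB -!mulr_sumr !sum_deltaF.
rewrite sumrB !sum_deltaF [in RHS]hX {1}hX /sg andbC; ring.
Qed.

Lemma bracket_mid a b c d i j :
  \sum_k \sum_l gbasis a b i k * g l k * gbasis c d l j =
    g c b * ((a == i)%:R * (d == j)%:R) - s a b * (g c a * ((b == i)%:R * (d == j)%:R))
    - s c d * (g d b * ((a == i)%:R * (c == j)%:R))
    + s a b * s c d * (g d a * ((b == i)%:R * (c == j)%:R)).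
Proof.
pose D (x y z t : I) := \sum_k \sum_l (y == k)%:R * ((z == l)%:R * (g l k * ((x == i)%:R * (t == j)%:R))).
have DE x y z t : D x y z t = g z y * ((x == i)%:R * (t == j)%:R).
  by rewrite /D; under eq_bigr => k _ do rewrite -mulr_sumr sum_deltaF; rewrite sum_deltaF.
rewrite -!DE /D !mulr_sumr -!sumrB -big_split; apply: eq_bigr => k _.
rewrite !mulr_sumr -!sumrB -big_split; apply: eq_bigr => l _.
by rewrite /gbasis /=; ring.
Qed.

(** The right side is nested in the shape [c * X + Y] so that [e2_lin] applies repeatedly. *)
Lemma bracket_gbasis a b c d :
  bracket g (par a (+) par b) (par c (+) par d) (gbasis a b) (gbasis c d) =
  fun i j => g c b * gbasis a d i j + ((- (s a b * g c a)) * gbasis b d i j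
    + ((- (s c d * g d b)) * gbasis a c i j + (s a b * s c d * g d a) * gbasis b c i j)).
Proof.
apply/funext => i; apply/funext => j; rewrite /bracket.
transitivity (\sum_k \sum_l gbasis a b i k * g l k * gbasis c d l j
  - sgn F ((par a (+) par b) && (par c (+) par d)) *
    \sum_k \sum_l gbasis c d i k * g l k * gbasis a b l j).
  rewrite mulr_sumr -sumrB; apply: eq_bigr => k _.
  by rewrite mulr_sumr -sumrB; apply: eq_bigr => l _; ring.
rewrite !bracket_mid (metricC hg c b) (metricC hg c a) (metricC hg d b) (metricC hg d a) /gbasis.
move: (metric_par hg (a := c) (b := b)) (metric_par hg (a := c) (b := a)).
move: (metric_par hg (a := d) (b := b)) (metric_par hg (a := d) (b := a)).
rewrite /sg.
by parity_cases; move=> p1 p2 p3 p4; try rewrite (p1 isT); try rewrite (p2 isT);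
  try rewrite (p3 isT); try rewrite (p4 isT); ring.
Qed.

Definition Lt (a b : I) : talg F m n := e2 (gbasis a b).

Lemma LtC a b : Lt a b = - (s a b *: Lt b a).
Proof.
rewrite -scaleN1r scalerA -[RHS]addr0.
have <- : e2 (fun _ _ : I => 0) = 0 :> talg F m n.
  by apply/funext => -[|? [|? [|? ?]]].
rewrite -e2_lin; congr e2; do 2![apply/funext => ?].
by rewrite gbasisC; ring.
Qed.

Lemma e2_expand X : in_g X -> e2 X = 2^-1 *: \sum_a \sum_b X a b *: Lt a b.
Proof.
move=> hX; apply/funext => r.
rewrite -[RHS]/(2^-1 * ((\sum_a \sum_b X a b *: Lt a b : talg F m n) r)) talg_sum.
under eq_bigr do rewrite talg_sum.
case: r => [|i [|j [|k r]]].
- by rewrite big1 ?mulr0 // => a _; rewrite big1 // => b _; apply: mulr0.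
- by rewrite big1 ?mulr0 // => a _; rewrite big1 // => b _; apply: mulr0.
- rewrite -[LHS]/(X i j) (_ : \sum_a _ = 2 * X i j) ?mulKf ?pnatr_eq0 //.
  exact: gbasis_sum.
- by rewrite big1 ?mulr0 // => a _; rewrite big1 // => b _; apply: mulr0.
Qed.

Lemma e4_expand (T : tensor4) : in_gg T -> e4 T = op4 Lt T.
Proof.
move=> [h1 h2]; rewrite /op4 /sum4; apply/funext => r.
rewrite -[RHS]/(4^-1 * ((\sum_a \sum_b \sum_c \sum_d T a b c d *: (Lt a b * Lt c d) : talg F m n) r)).
rewrite !talg_sum; under eq_bigr do rewrite !talg_sum.
under eq_bigr do under eq_bigr do rewrite !talg_sum.
under eq_bigr do under eq_bigr do under eq_bigr do rewrite !talg_sum.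
under eq_bigr do under eq_bigr do under eq_bigr do under eq_bigr do rewrite /Lt e2M.
have z : 4^-1 * (\sum_(a : I) \sum_(b : I) \sum_(c : I) \sum_(d : I) T a b c d * 0) = 0.
  rewrite big1 ?mulr0 // => a _; rewrite big1 // => b _; rewrite big1 // => c _.
  by rewrite big1 // => d _; rewrite mulr0.
case: r => [|i [|j [|k [|l [|? r]]]]]; try by rewrite -[LHS]z.
rewrite -[LHS]/(T i j k l).
transitivity (4^-1 * \sum_a \sum_b (2 * T a b k l) * gbasis a b i j).
  rewrite (@gbasis_sum (fun a b => 2 * T a b k l)); first by field.
  by move=> x y; rewrite h1; ring.
congr (_ * _); apply: eq_bigr => a _; apply: eq_bigr => b _.
rewrite -(@gbasis_sum (T a b)); last by move=> x y; apply: h2.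
rewrite mulr_suml; apply: eq_bigr => c _; rewrite mulr_suml; apply: eq_bigr => d _.
rewrite -[RHS]/(T a b c d * (gbasis a b i j * gbasis c d k l)); ring.
Qed.

Lemma Lt_inTg a b : inTg (Lt a b).
Proof. exact/Tg_emb/gbasis_in. Qed.

End Basis.

(** * Relations in the ideal for arbitrary elements of [g (x) g] *)

Section JosephRelations.
Variables (F : numClosedFieldType) (m n : nat).
Local Notation I := 'I_(m + n.*2).
Local Notation tensor4 := (I -> I -> I -> I -> F).
Local Notation TA := (talg F m n).
Variable g : I -> I -> F.
Hypothesis hg : is_osp_metric g.
Variable lam : F.
Local Notation s := (sg F).
Local Notation M := (sdim F m n).
Local Notation J := (J1 g lam).
Local Notation L := (@Lt F m n).

Section TwoSidedIdeal.
Variable S : tens F m n -> Prop.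
Implicit Types t u : TA.

Lemma tideal_eq t u : t = u -> tideal S t -> tideal S u.
Proof. by move=> ->. Qed.
Lemma tideal_D t u : tideal S t -> tideal S u -> tideal S (t + u).
Proof. exact: ti_add. Qed.
Lemma tideal_Z c t : tideal S t -> tideal S (c *: t).
Proof. exact: ti_scale. Qed.
Lemma tideal_N t : tideal S t -> tideal S (- t).
Proof. by rewrite -scaleN1r; apply: tideal_Z. Qed.
Lemma tideal_B t u : tideal S t -> tideal S u -> tideal S (t - u).
Proof. by move=> ht hu; apply: tideal_D => //; apply: tideal_N. Qed.
Lemma tideal_sum (T : Type) (r : seq T) (f : T -> TA) :
  (forall i, tideal S (f i)) -> tideal S (\sum_(i <- r) f i).
Proof.
move=> h; elim/big_rec: _ => [|i x _ hx]; first exact: ti_zero.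
exact: tideal_D.
Qed.
Lemma tideal_Ml t u : inTg u -> tideal S t -> tideal S (u * t).
Proof. exact: ti_mull. Qed.
Lemma tideal_Mr t u : inTg u -> tideal S t -> tideal S (t * u).
Proof. exact: ti_mulr. Qed.
End TwoSidedIdeal.

Lemma J_comm a b c d : J (L a b * L c d
  - sgn F ((par a (+) par b) && (par c (+) par d)) *: (L c d * L a b) - comm4 g L a b c d).
Proof.
have h : Defs.relU g (L a b * L c d + (- sgn F ((par a (+) par b) && (par c (+) par d))) *: (L c d * L a b)
    + (-1) *: e2 (bracket g (par a (+) par b) (par c (+) par d) (gbasis F a b) (gbasis F c d))).
  exists (par a (+) par b), (par c (+) par d), (gbasis F a b), (gbasis F c d).
  by split=> //; [apply: gbasis_in|apply: gbasis_in|apply: gbasis_homog|apply: gbasis_homog].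
have := @ti_gen F m n (fun t => Defs.relU g t \/ joseph_gen g lam t) _ (or_introl h).
rewrite bracket_gbasis // !e2_lin.
have -> : e2 (fun i j => (s a b * s c d * g d a) * gbasis F b c i j) = (s a b * s c d * g d a) *: L b c.
  rewrite -[RHS]addr0; have <- : e2 (fun _ _ : I => 0) = 0 :> TA.
    by apply/funext => -[|? [|? [|? ?]]].
  by rewrite -e2_lin; congr e2; do 2![apply/funext => ?]; rewrite addr0.
apply: tideal_eq; rewrite /comm4 /Lt.
by linear_coefs (F : pzRingType); ring.
Qed.

Hypotheses (hM1 : M != 1) (hM2 : M != 2).

(** The Joseph generator with [X (x) Y] replaced by any tensor: [swap4] carries the signed product
    [Y X]. Every term is linear in [T], so membership in the ideal passes from pure tensors to
    sums. *)
Definition josephT (T : tensor4) : TA :=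
  e4 T + e4 (swap4 T) - 2 *: e4 (proj4 g T) - (2 * lam * tr2 g (tr4 g T)) *: @tunit F m n.

Lemma josephT_lin c T U :
  josephT (fun i j k l => c * T i j k l + U i j k l) = c *: josephT T + josephT U.
Proof.
rewrite /josephT.
have -> : swap4 (fun i j k l => c * T i j k l + U i j k l) =
  fun i j k l => c * swap4 T i j k l + swap4 U i j k l.
  by do 4![apply/funext => ?]; rewrite /swap4; ring.
have -> : proj4 g (fun i j k l => c * T i j k l + U i j k l) =
  fun i j k l => c * proj4 g T i j k l + proj4 g U i j k l.
  by do 4![apply/funext => ?]; rewrite proj4_lin.
have -> : tr4 g (fun i j k l => c * T i j k l + U i j k l) =
  fun i j => c * tr4 g T i j + tr4 g U i j.
  by do 2![apply/funext => ?]; rewrite tr4_lin.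
rewrite !e4_lin tr2_lin.
by linear_coefs (F : pzRingType); ring.
Qed.

Lemma josephT0 : josephT (fun _ _ _ _ => 0) = 0.
Proof.
have := josephT_lin (-1) (fun _ _ _ _ => 0) (fun _ _ _ _ => 0).
rewrite scaleN1r addNr => <-; congr josephT.
by do 4![apply/funext => ?]; ring.
Qed.

Lemma J_josephT_sum (f : I -> tensor4) :
  (forall a, J (josephT (f a))) -> J (josephT (fun i j k l => \sum_a f a i j k l)).
Proof.
move=> h; elim: (index_enum I) => [|a r IH].
  have -> : (fun i j k l => \sum_(a <- [::]) f a i j k l) = fun _ _ _ _ => 0.
    by do 4![apply/funext => ?]; rewrite big_nil.
  by rewrite josephT0; apply: ti_zero.
have -> : (fun i j k l => \sum_(a <- a :: r) f a i j k l) =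
    fun i j k l => 1 * f a i j k l + \sum_(a <- r) f a i j k l.
  by do 4![apply/funext => ?]; rewrite big_cons mul1r.
by rewrite josephT_lin scale1r; exact: (tideal_D (h a) IH).
Qed.

Lemma J_josephT_Z c T : J (josephT T) -> J (josephT (fun i j k l => c * T i j k l)).
Proof.
move=> h; rewrite (_ : (fun _ => _) = fun i j k l => c * T i j k l + 0).
  by rewrite josephT_lin josephT0 addr0; apply: tideal_Z.
by do 4![apply/funext => ?]; rewrite addr0.
Qed.

Lemma J_josephT_basis a b c d :
  J (josephT (fun i j k l => gbasis F a b i j * gbasis F c d k l)).
Proof.
set T := fun i j k l => _.
have hT : in_gg T.
  split=> i j k l; rewrite /T.
    by rewrite {1}(gbasis_in F a b i j); ring.
  by rewrite {1}(gbasis_in F c d k l); ring.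
apply: ti_gen; right.
exists (par a (+) par b), (par c (+) par d), (gbasis F a b), (gbasis F c d), (proj4 g T); split.
- by split; apply: gbasis_in.
- exact: gbasis_homog.
- exact: gbasis_homog.
- by split; [apply: proj4_cartan|apply: proj4_complement].
rewrite form_tr -/T /josephT.
have -> : e4 (swap4 T) = sgn F ((par a (+) par b) && (par c (+) par d)) *: (L c d * L a b).
  rewrite /Lt e2M -[RHS]addr0; have <- : e4 (fun _ _ _ _ : I => 0) = 0 :> TA.
    by apply/funext => -[|? [|? [|? [|? [|? ?]]]]].
  rewrite -e4_lin; congr e4; apply/funext => i; apply/funext => j; apply/funext => k; apply/funext => l.
  rewrite addr0 /swap4 /T.
  (* Where an entry is nonzero, homogeneity fixes the parity of its indices; the index-dependent
     sign of [swap4] becomes the constant sign of the generator. *)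
  case: (eqVneq (gbasis F a b k l) 0) => [->|/(gbasis_homog)->]; first by rewrite !(mul0r, mulr0).
  case: (eqVneq (gbasis F c d i j) 0) => [->|/(gbasis_homog)->]; first by rewrite !(mul0r, mulr0).
  by rewrite andbC mulrCA mulrA; ring.
have -> : e4 T = L a b * L c d by rewrite /Lt e2M.
by rewrite -addrA -scaleNr -[in X in _ + (_ + X)]scaleNr.
Qed.

Lemma J_josephT (W : tensor4) : in_gg W -> J (josephT W).
Proof.
move=> [h1 h2].
rewrite (_ : W = fun i j k l => 4^-1 * \sum_a \sum_b \sum_c \sum_d
    (W a b c d * (gbasis F a b i j * gbasis F c d k l))).
  apply: J_josephT_Z; do 4![apply: J_josephT_sum => ?].
  exact/J_josephT_Z/J_josephT_basis.
apply/funext => i; apply/funext => j; apply/funext => k; apply/funext => l.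
transitivity (4^-1 * \sum_a \sum_b (2 * W a b k l) * gbasis F a b i j).
  rewrite (@gbasis_sum _ _ _ (fun a b => 2 * W a b k l)); first by field.
  by move=> x y; rewrite h1; ring.
congr (_ * _); apply: eq_bigr => a _; apply: eq_bigr => b _.
rewrite -(@gbasis_sum _ _ _ (W a b)); last by move=> x y; apply: h2.
rewrite mulr_suml; apply: eq_bigr => c _; rewrite mulr_suml; apply: eq_bigr => d _.
ring.
Qed.

Lemma e4_swap_sym (W : tensor4) : sym_gg W -> swap4 W = W.
Proof. by case=> _ h; do 4![apply/funext => ?]; rewrite /swap4 -h. Qed.

Lemma e4_eq0 (T : tensor4) : (forall i j k l, T i j k l = 0) -> e4 T = 0.
Proof.
move=> h; apply/funext => -[|? [|? [|? [|? [|? ?]]]]] //.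
by rewrite -[LHS]/(T _ _ _ _) h.
Qed.

(** Cartan component and trace of [Q] vanish and [Q] equals its swap, so the Joseph relation reduces
    to [2 Q]. *)
Lemma J_alt4 (Q : tensor4) : alt4 Q -> J (e4 Q).
Proof.
move=> hQ; have hs := alt4_sym hQ; have := J_josephT hs.1.
rewrite /josephT e4_swap_sym // (_ : tr2 g _ = 0); last first.
  by rewrite /tr2 big1 // => i _; rewrite big1 // => j _; rewrite alt4_tr ?mulr0.
rewrite [e4 (proj4 g Q)]e4_eq0; last exact/(proj4_q hg hs)/alt4_qid.
rewrite scaler0 mulr0 scale0r !subr0 => /(tideal_Z 2^-1).
by rewrite -mulr2n -scaler_nat scalerA mulVf ?pnatr_eq0 // scale1r.
Qed.

Lemma J_phi S : sym2 S -> J (e4 (phimap g S) - (lam * (M - 1) / 2 * tr2 g S) *: @tunit F m n).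
Proof.
move=> hS; have hs := sym_phi hg hS; have := J_josephT hs.1.
rewrite /josephT e4_swap_sym // tr2_tr4_phi // [e4 (proj4 g _)]e4_eq0; last exact: proj4_phi.
rewrite scaler0 subr0 => /(tideal_Z 2^-1); apply: tideal_eq.
by linear_coefs (F : pzRingType); field.
Qed.
End JosephRelations.

(** * Alternating tensors built from products of generators *)

Section AlternatingBasis.
Variables (F : numClosedFieldType) (m n : nat).
Local Notation I := 'I_(m + n.*2).
Local Notation s := (sg F).
Local Notation E := (gbasis F).

Definition sgab (a b c : I) : F := sgn F (par c && (par a (+) par b)).

Definition symbasis (a b c d i j k l : I) : F :=
  E a b i j * E c d k l
  + sgn F ((par a (+) par b) && (par c (+) par d)) * (E c d i j * E a b k l).
(** A multiple of the full antisymmetrization of [L_ab L_cd]: three signed terms suffice because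
    [symbasis] already has the other symmetries. *)
Definition altbasis (a b c d i j k l : I) : F :=
  symbasis a b c d i j k l + sgab a b c * symbasis c a b d i j k l
  + sgab b c a * symbasis b c a d i j k l.

Lemma altbasis_alt a b c d : alt4 (altbasis a b c d).
Proof.
split=> i j k l; rewrite /altbasis /symbasis.
- rewrite (gbasis_in F a b i j) (gbasis_in F c d i j) (gbasis_in F c a i j)
    (gbasis_in F b d i j) (gbasis_in F b c i j) (gbasis_in F a d i j) /sg; ring.
(* A Kronecker delta forces equal parities. Making this an explicit factor at the exchanged slots
   [j] and [k] preserves the information when the deltas are generalized to free variables. *)
- have hd (x y : I) : (x == y)%:R = (par x == par y)%:R * (x == y)%:R :> F.
    by case: (eqVneq x y) => [->|_]; rewrite ?eqxx ?mulr1 ?mulr0.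
  rewrite /gbasis (hd a j) (hd b j) (hd c j) (hd d j) (hd a k) (hd b k) (hd c k) (hd d k).
  move: (a == i)%:R (b == i)%:R (c == i)%:R (d == i)%:R => ai bi ci di.
  move: (a == l)%:R (b == l)%:R (c == l)%:R (d == l)%:R => al bl cl dl.
  move: (a == j)%:R (b == j)%:R (c == j)%:R (d == j)%:R => aj bj cj dj.
  move: (a == k)%:R (b == k)%:R (c == k)%:R (d == k)%:R => ak bk ck dk.
  rewrite /sgab /sg; parity_cases; rewrite ?mul1r ?mul0r ?mulr0 ?subr0 ?sub0r; ring.
- rewrite (gbasis_in F a b k l) (gbasis_in F c d k l) (gbasis_in F c a k l)
    (gbasis_in F b d k l) (gbasis_in F b c k l) (gbasis_in F a d k l) /sg; ring.
Qed.
End AlternatingBasis.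

(** * Collapse of a subspace stable under multiplication by the generators *)

Section Collapse.
Variables (F : numClosedFieldType) (m n : nat).
Local Notation I := 'I_(m + n.*2).
Variable g : I -> I -> F.
Hypothesis hg : is_osp_metric g.
Local Notation s := (sg F).
Local Notation M := (sdim F m n).

Lemma sum_metric_metric (V : lmodType F) (x : I) (f : I -> V) :
  \sum_c \sum_d g c d *: (g d x *: f c) = sgn F (par x) *: f x.
Proof.
under eq_bigr => c _.
  under eq_bigr => d _ do rewrite scalerA.
  rewrite -scaler_suml metric_mid //.
over.
rewrite -(sum_delta x (fun c => sgn F (par x) *: f c)); apply: eq_bigr => c _.
rewrite mulrC -scalerA eq_sym; case: eqP => [->//|]; by rewrite !scale0r.
Qed.

Lemma sum_metric_metricT (V : lmodType F) (x : I) (f : I -> V) :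
  \sum_c \sum_d g c d *: (g c x *: f d) = f x.
Proof.
rewrite exchange_big /=; under eq_bigr => d _.
  under eq_bigr => c _ do rewrite scalerA mulrC.
  rewrite -scaler_suml metricK //.
over.
by rewrite -[RHS](sum_delta x); apply: eq_bigr => d _; rewrite eq_sym.
Qed.

Lemma eq_oppr_eq0 (V : lmodType F) (x : V) : x = - x -> x = 0.
Proof.
move=> e; have : 2^-1 *: (x + x) = 0 by rewrite {1}e addNr scaler0.
by rewrite -mulr2n -scaler_nat scalerA mulVf ?pnatr_eq0 // scale1r.
Qed.


Variables (A : algType F) (L : I -> I -> A).
Hypothesis LC : forall a b, L a b = - (s a b *: L b a).
Local Notation L2 := (Lsq g L).

Definition cyc (f : I -> I -> I -> A) a b c : A :=
  f a b c + sgab F a b c *: f c a b + sgab F b c a *: f b c a.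

Variable J : A -> Prop.
Hypotheses (JD : forall t u, J t -> J u -> J (t + u)) (JZ : forall c t, J t -> J (c *: t)).
Hypothesis J0 : J 0.
Hypothesis JMl : forall a b t, J t -> J (L a b * t).
Hypothesis JMr : forall a b t, J t -> J (t * L a b).
Variable kappa : F.
Let mu := (M - 2) / 2.
Hypothesis Jcomm : forall a b c d, J (L a b * L c d
  - sgn F ((par a (+) par b) && (par c (+) par d)) *: (L c d * L a b) - comm4 g L a b c d).
Hypothesis Jalt : forall a b c d, J (cyc (fun a b c => L a b * L c d +
  sgn F ((par a (+) par b) && (par c (+) par d)) *: (L c d * L a b)) a b c).
Hypothesis Jsq : forall a b, J (L2 a b + s a b *: L2 b a - (2 * kappa * g b a) *: 1).

Let J_eq t u : t = u -> J t -> J u. Proof. by move=> ->. Qed.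

Let J_sum (T : Type) (r : seq T) (f : T -> A) :
  (forall i, J (f i)) -> J (\sum_(i <- r) f i).
Proof. by move=> h; elim/big_rec: _ => [|i x _ hx] //; exact: JD. Qed.

(** [g] is supersymmetric and [L] super-antisymmetric. This removes the last term of the contracted
    supercommutator. *)
Lemma metric_gbasis_sum : \sum_c \sum_d g c d *: L c d = 0.
Proof.
apply: eq_oppr_eq0; rewrite {1}exchange_big -sumrN; apply: eq_bigr => c _.
rewrite -sumrN; apply: eq_bigr => d _ /=.
rewrite (metricC hg c d) (LC d c) /sg; linear_coefs (F : pzRingType).
all: by parity_cases; ring.
Qed.

Lemma J_Lsq_comm a b : J (L2 a b - s a b *: L2 b a - (M - 2) *: L a b).
Proof.
have h : J (\sum_c \sum_d g c d *: (L a c * L d b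
    - sgn F ((par a (+) par c) && (par d (+) par b)) *: (L d b * L a c) - comm4 g L a c d b)).
  by do 2![apply: J_sum => ?]; apply/JZ/Jcomm.
move: h; apply: J_eq.
under eq_bigr => c _ do under eq_bigr => d _ do rewrite !scalerBr.
under eq_bigr => c _ do rewrite !sumrB.
rewrite !sumrB (Lsq_swap hg LC).
congr (_ - _ - _).
(* The contracted terms of [comm4] give [M], [-1], [-1] and [0] times [L a b], which accounts for
   the factor [M - 2]. *)
transitivity (\sum_c \sum_d ((g c d * g d c) *: L a b - g c d *: (g d a *: (s a c *: L c b))
  - g c d *: (g c b *: L a d) + g b a *: (g c d *: L c d))).
  apply: eq_bigr => c _; apply: eq_bigr => d _; rewrite /comm4.
  move: (metricC hg c b) (@metric_par _ _ _ _ hg c d) (@metric_par _ _ _ _ hg b a) => -> p1 p2.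
  rewrite /sg; linear_coefs (F : pzRingType);
  move: p1 p2; parity_cases; move=> p1 p2;
  try rewrite (p1 isT); try rewrite (p2 isT); ring.
under eq_bigr => c _ do rewrite big_split sumrB sumrB /= -scaler_suml -scaler_sumr.
rewrite big_split sumrB sumrB /= -scaler_suml -scaler_sumr metric_gbasis_sum scaler0 addr0.
rewrite metric_trace // sum_metric_metric sum_metric_metricT scalerA.
rewrite (_ : sgn F (par a) * s a a = 1); last by rewrite /sg; parity_cases; ring.
by linear_coefs (F : pzRingType); ring.
Qed.


Lemma J_Lsq a b : J (L2 a b - (kappa * g b a) *: 1 - mu *: L a b).
Proof.
have := JZ 2^-1 (JD (Jsq a b) (J_Lsq_comm a b)).
by apply: J_eq; rewrite /mu; linear_coefs (F : pzRingType); field.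
Qed.

(** [Jalt] plus the cyclic sum of the supercommutation relations is twice the cyclic sum of
    [L_ab L_cd]; the structure constants recombine into the metric terms. *)
Lemma J_cyc a b c d :
  J (cyc (fun a b c => L a b * L c d) a b c - cyc (fun a b c => g d c *: L a b) a b c).
Proof.
have h2 : J (cyc (fun a b c => L a b * L c d
  - sgn F ((par a (+) par b) && (par c (+) par d)) *: (L c d * L a b) - comm4 g L a b c d) a b c).
  by rewrite /cyc; apply: JD; [apply: JD|] => //; apply: JZ.
have := JZ 2^-1 (JD (Jalt a b c d) h2); apply: J_eq.
rewrite /cyc /comm4 (LC c a) (LC c b) (LC b a).
rewrite (metricC hg a b) (metricC hg b c) (metricC hg a c) (metricC hg a d) (metricC hg b d) (metricC hg c d).
have p1 := @metric_par _ _ _ _ hg a b; have p2 := @metric_par _ _ _ _ hg a c.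
have p3 := @metric_par _ _ _ _ hg b c; have p4 := @metric_par _ _ _ _ hg a d.
have p5 := @metric_par _ _ _ _ hg b d; have p6 := @metric_par _ _ _ _ hg c d.
rewrite mulNr mulrN -!scalerAl -!scalerAr.
rewrite /sgab /sg; linear_coefs (F : pzRingType).
all: by move: p1 p2 p3 p4 p5 p6; parity_cases; move=> p1 p2 p3 p4 p5 p6;
  try rewrite (p1 isT); try rewrite (p2 isT); try rewrite (p3 isT);
  try rewrite (p4 isT); try rewrite (p5 isT); try rewrite (p6 isT); field.
Qed.

Lemma J_cyc_metric a b c e :
  J ((kappa + mu - 1) *: cyc (fun a b c => g e c *: L a b) a b c).
Proof.
have h1 : J (\sum_d \sum_k g d k *: ((cyc (fun a b c => L a b * L c d) a b c
    - cyc (fun a b c => g d c *: L a b) a b c) * L k e)).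
  by do 2![apply: J_sum => ?]; apply/JZ/JMr/J_cyc.
pose H x y z := \sum_d \sum_k g d k *: (L x y * L z d * L k e).
pose K x y z := \sum_d \sum_k g d k *: (g d z *: (L x y * L k e)).
have HE x y z : H x y z = L x y * L2 z e.
  rewrite /H /Lsq mulr_sumr; apply: eq_bigr => d _; rewrite mulr_sumr.
  by apply: eq_bigr => k _; rewrite -scalerAr mulrA.
have KE x y z : K x y z = L x y * L z e.
  exact: (sum_metric_metricT z (fun k => L x y * L k e)).
have e1 : \sum_d \sum_k g d k *: ((cyc (fun a b c => L a b * L c d) a b c
    - cyc (fun a b c => g d c *: L a b) a b c) * L k e) =
    cyc (fun a b c => L a b * L2 c e) a b c - cyc (fun a b c => L a b * L c e) a b c.
  rewrite /cyc -!HE -!KE /H /K !scaler_sumr -!big_split -sumrB /=; apply: eq_bigr => d _.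
  rewrite !scaler_sumr -!big_split -sumrB /=; apply: eq_bigr => k _.
  rewrite !(mulrDl, mulNr) -!scalerAl.
  by linear_coefs (F : pzRingType); ring.
have h2 : J (cyc (fun a b c => L a b * (L2 c e - (kappa * g e c) *: 1 - mu *: L c e)) a b c).
  rewrite /cyc; apply: JD; [apply: JD|]; rewrite -?scalerAr; do ?apply: JZ; apply/JMl/J_Lsq.
(* [h1] minus [h2] still contains [mu - 1] times the cyclic sum of [L_ab L_ce]. A second use of
   [J_cyc] trades it for the metric terms, which completes the coefficient [kappa + mu - 1]. *)
have := JD (JD h1 (JZ (-1) h2)) (JZ (1 - mu) (J_cyc a b c e)); apply: J_eq.
rewrite e1 /cyc !(mulrDr, mulrN) -!scalerAr !mulr1.
by linear_coefs (F : pzRingType); ring.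
Qed.

Lemma J_generator a b : (M - 2) * (kappa + mu - 1) != 0 -> J (L a b).
Proof.
move=> nz; have h : J (\sum_c \sum_d g c d *: ((kappa + mu - 1) *: cyc (fun a b c => g d c *: L a b) a b c)).
  by do 2![apply: J_sum => ?]; apply/JZ/J_cyc_metric.
have := JZ ((M - 2) * (kappa + mu - 1))^-1 h; apply: J_eq.
rewrite (_ : \sum_c _ = ((M - 2) * (kappa + mu - 1)) *: L a b); first by rewrite scalerA mulVf // scale1r.
(* Of the three cyclic terms the first contributes [M *: L a b] and each of the others [- L a b]. *)
transitivity ((kappa + mu - 1) *: (M *: L a b + (\sum_c \sum_d g c d *: (g d b *: (sgab F a b c *: L c a))
   + \sum_c \sum_d g c d *: (g d a *: (sgab F b c a *: L b c))))).
  rewrite -(metric_trace hg) scaler_suml -!big_split scaler_sumr /=; apply: eq_bigr => c _.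
  rewrite scaler_suml -!big_split scaler_sumr /=; apply: eq_bigr => d _.
  by rewrite /cyc; linear_coefs (F : pzRingType); ring.
rewrite !sum_metric_metric (LC b a) /sgab /sg.
linear_coefs (F : pzRingType); parity_cases; ring.
Qed.
End Collapse.

(** * The ideal contains [g] away from the critical value, and 1 if moreover [lam] is nonzero *)

Section JosephCollapse.
Variables (F : numClosedFieldType) (m n : nat).
Local Notation I := 'I_(m + n.*2).
Local Notation TA := (talg F m n).
Variable g : I -> I -> F.
Hypothesis hg : is_osp_metric g.
Variable lam : F.
Local Notation s := (sg F).
Local Notation M := (sdim F m n).
Local Notation J := (J1 g lam).
Local Notation L := (@Lt F m n).
Hypotheses (hM1 : M != 1) (hM2 : M != 2).

Lemma half_sum_phi (A : algType F) (x y u : A) (c : F) :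
  4 *: (4^-1 *: (x + y) - (lam * (M - 1) / 2 * (2 * c)) *: u)
  = x + y - (2 * (2 * lam * (M - 1)) * c) *: u.
Proof. by linear_coefs (F : pzRingType); field. Qed.

Lemma J_Lsq_sym a b : J (Lsq g L a b + s a b *: Lsq g L b a
  - (2 * (2 * lam * (M - 1)) * g b a) *: @tunit F m n).
Proof.
(* The supersymmetrized elementary tensor at [(a, b)]; summed against [Lsq] it returns the two terms
   of the claim. *)
pose S i j : F := (a == i)%:R * (b == j)%:R + s a b * ((b == i)%:R * (a == j)%:R).
have hS : sym2 S.
  move=> i j; rewrite /S /sg -!natrM !mulnb (andbC (a == j)) (andbC (b == j)).
  case: (boolP ((a == i) && (b == j))) => [/andP[/eqP ei /eqP ej]|_];
  case: (boolP ((b == i) && (a == j))) => [/andP[/eqP ei' /eqP ej']|_]; subst => //;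
  by parity_cases; ring.
have tS : tr2 g S = 2 * g b a.
  transitivity (\sum_i \sum_j ((b == i)%:R * ((a == j)%:R * g i j)
     + (a == i)%:R * ((b == j)%:R * (s a b * g i j)))).
    by apply: eq_bigr => i _; apply: eq_bigr => j _; rewrite /S; ring.
  under eq_bigr => i _ do rewrite big_split /= -!mulr_sumr !sum_deltaF.
  rewrite big_split /= !sum_deltaF [in RHS](metricC hg a b) (metricC hg a b); ring.
have := tideal_Z 4 (J_phi hg lam hM1 hM2 hS).
rewrite (e4_expand (sym_phi hg hS).1) op4_phi; last exact: LtC.
rewrite tS (_ : \sum_i _ = Lsq g L a b + s a b *: Lsq g L b a).
  by apply: tideal_eq; rewrite half_sum_phi.
transitivity (\sum_i \sum_j ((a == i)%:R *: ((b == j)%:R *: Lsq g L i j)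
     + (b == i)%:R *: ((a == j)%:R *: (s a b *: Lsq g L i j)))).
  by apply: eq_bigr => i _; apply: eq_bigr => j _; rewrite /S scalerDl !scalerA; congr (_ + _ *: _); ring.
under eq_bigr => i _ do rewrite big_split /= -!scaler_sumr !sum_delta.
by rewrite big_split /= !sum_delta.
Qed.


Lemma J_alt_cyc a b c d : J (cyc (fun a b c => L a b * L c d +
  sgn F ((par a (+) par b) && (par c (+) par d)) *: (L c d * L a b)) a b c).
Proof.
have h1 : J (e4 (altbasis F a b c d)) by apply: J_alt4 => //; apply: altbasis_alt.
move: h1; apply: tideal_eq.
have ea x y z t : e4 (symbasis F x y z t) = L x y * L z t
    + sgn F ((par x (+) par y) && (par z (+) par t)) *: (L z t * L x y).
  rewrite addrC /Lt !e2M -e4_lin; congr e4.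
  by do 4![apply/funext => ?]; rewrite /symbasis addrC.
rewrite /cyc -!ea -addrA [RHS]addrC -addrA -!e4_lin; congr e4.
by do 4![apply/funext => ?]; rewrite /altbasis; ring.
Qed.

Definition critical := - ((M - 4) / (4 * (M - 1))).

Lemma J_Lt a b : lam != critical -> J (L a b).
Proof.
move=> hl.
refine (@J_generator F m n g hg TA L (@LtC F m n) J _ _ _ _ _ (2 * lam * (M - 1)) _ _ _ a b _).
- exact: tideal_D.
- exact: tideal_Z.
- exact: ti_zero.
- by move=> x y t; apply: tideal_Ml; apply: Lt_inTg.
- by move=> x y t; apply: tideal_Mr; apply: Lt_inTg.
- exact: J_comm.
- exact: J_alt_cyc.
- exact: J_Lsq_sym.
have h1 : M - 1 != 0 by rewrite subr_eq0.
have h2 : M - 2 != 0 by rewrite subr_eq0.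
rewrite mulf_neq0 //; apply: contra hl => /eqP e.
(* [kappa + mu - 1] is [2 (M - 1)] times the difference of [lam] and [critical]. *)
have -> : lam = critical + (2 * lam * (M - 1) + (M - 2) / 2 - 1) / (2 * (M - 1)).
  by rewrite /critical; field; rewrite h1.
by rewrite e mul0r addr0.
Qed.

Lemma J_g X : lam != critical -> in_g X -> J (emb2 X).
Proof.
move=> hl hX; rewrite -[emb2 X]/(e2 X) e2_expand //; apply: tideal_Z.
by do 2![apply: tideal_sum => ?]; apply/tideal_Z/J_Lt.
Qed.

Lemma metric_nonzero : (0 < m + n.*2)%N -> exists a b, g a b != 0.
Proof.
move=> h; pose b : I := Ordinal h.
case: (altP (@existsP _ (fun a : I => g a b != 0))) => [[a ha]|]; first by exists a, b.
rewrite negb_exists => /forallP h0.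
have := metricK hg b b; rewrite eqxx big1 => [|a _].
  by move/esym/eqP; rewrite oner_eq0.
by have := h0 a; rewrite negbK => /eqP ->; rewrite mul0r.
Qed.

(** With all generators in the ideal, the contraction relation leaves its scalar term
    [4 lam (M-1) g_ba], which is invertible at a nonzero entry of the metric. *)
Lemma J_full t : (0 < m + n.*2)%N -> lam != critical -> lam != 0 -> inTg t -> J t.
Proof.
move=> hI hl hl0 ht; have [b [a hab]] := metric_nonzero hI.
have h1 : J (@tunit F m n).
  have hL : J (Lsq g L a b + s a b *: Lsq g L b a).
    apply: tideal_D; last apply: tideal_Z.
      by do 2![apply: tideal_sum => ?]; apply/tideal_Z/tideal_Ml/J_Lt; first exact: Lt_inTg.
    by do 2![apply: tideal_sum => ?]; apply/tideal_Z/tideal_Ml/J_Lt; first exact: Lt_inTg.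
  have := tideal_B hL (J_Lsq_sym a b).
  rewrite opprB addrC subrK => /(tideal_Z (2 * (2 * lam * (M - 1)) * g b a)^-1).
  by rewrite scalerA mulVf ?scale1r // !mulf_neq0 ?pnatr_eq0 ?subr_eq0.
by have := tideal_Ml (u := t) ht h1; rewrite mulr1.
Qed.

Lemma tideal_mono (S : tens F m n -> Prop) (S' : tens F m n -> Prop) t :
  (forall u, S u -> tideal S' u) -> tideal S t -> tideal S' t.
Proof.
move=> h; elim=> {t} [t|||||t u hu _ ht|t u e _].
- exact: h.
- exact: ti_zero.
- by move=> t u _ ht _ hu; apply: ti_add.
- by move=> c t _; apply: ti_scale.
- by move=> u t hu _; apply: ti_mull.
- by apply: ti_mulr.
- exact: ti_ext e.
Qed.

Lemma J_zero_aug t : lam = 0 -> lam != critical -> J t <-> augU g t.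
Proof.
move=> l0 hl; split; apply: tideal_mono => u [h|].
- by apply: ti_gen; left.
(* For [lam = 0] the generator has no constant term: it is a combination of products whose right
   factor lies in [g]. *)
- move=> [p [q [X [Y [V [[hX hY] _ _ [[hV _ _] _] ->]]]]]].
  have hX' Z : in_g Z -> augU g (emb2 Z) by move=> hZ; apply: ti_gen; right; exists Z.
  apply: ti_add; first apply: ti_add.
  + by apply: ti_mull; [apply: Tg_emb|apply: hX'].
  + by apply: ti_scale; apply: ti_mull; [apply: Tg_emb|apply: hX'].
  apply: ti_add.
  + apply: ti_scale; rewrite -[emb4 V]/(e4 V) e4_expand; last by case: hV.
    apply: tideal_Z; do 4![apply: tideal_sum => ?]; apply/tideal_Z/tideal_Ml.
      exact: Lt_inTg.
    exact/hX'/gbasis_in.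
  apply: (@ti_ext _ _ _ _ (@tzero F m n)); last exact: ti_zero.
  by move=> r; rewrite /tscale l0 mulr0 mul0r oppr0 mul0r.
- by apply: ti_gen; left.
- by move=> [X [hX ->]]; apply: J_g.
Qed.
End JosephCollapse.

(** * Realization in a Weyl superalgebra *)

Section WeylRealization.
Variables (F : numClosedFieldType) (m n : nat).
Local Notation I := 'I_(m + n.*2).
Local Notation tensor4 := (I -> I -> I -> I -> F).
Variable g : I -> I -> F.
Hypothesis hg : is_osp_metric g.
Local Notation s := (sg F).
Local Notation M := (sdim F m n).
Variables (A : algType F) (x d : I -> A).
Hypothesis xC : forall a b, x a * x b = s a b *: (x b * x a).
Hypothesis dC : forall a b, d a * d b = s a b *: (d b * d a).
Hypothesis dx : forall b c, d b * x c = s b c *: (x c * d b) + g c b *: 1.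

Definition wgen (a b : I) : A := x a * d b.
Definition wrot (a b : I) : A := wgen a b - s a b *: wgen b a.
Definition euler : A := \sum_b \sum_c g b c *: (x b * d c).
Definition radius : A := \sum_b \sum_c g b c *: (x b * x c).
Definition laplace : A := \sum_b \sum_c g b c *: (d b * d c).

Lemma wrotC a b : wrot a b = - (s a b *: wrot b a).
Proof.
rewrite /wrot; move: (wgen a b) (wgen b a) => u v.
by rewrite /sg; linear_coefs (F : pzRingType); parity_cases; ring.
Qed.

Lemma wgen_mul a b c e : wgen a b * wgen c e =
  s b c *: (x a * x c * (d b * d e)) + g c b *: wgen a e.
Proof.
rewrite /wgen mulrA -(mulrA (x a)) dx mulrDr mulrDl -!(scalerAl, scalerAr) mulr1.
by rewrite !mulrA.
Qed.

Lemma wgen_comm a b c e : wgen a b * wgen c e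
  - sgn F ((par a (+) par b) && (par c (+) par e)) *: (wgen c e * wgen a b) =
  g c b *: wgen a e - (sgn F ((par a (+) par b) && (par c (+) par e)) * g a e) *: wgen c b.
Proof.
rewrite !wgen_mul (xC a c) (dC b e) -!(scalerAl, scalerAr).
move: (x c * x a * _) (wgen _ _) (wgen _ _) => u v w.
by rewrite /sg; linear_coefs (F : pzRingType); parity_cases; ring.
Qed.

Lemma wrot_comm a b c e : wrot a b * wrot c e
  - sgn F ((par a (+) par b) && (par c (+) par e)) *: (wrot c e * wrot a b)
  = comm4 g wrot a b c e.
Proof.
pose C a b c e := wgen a b * wgen c e
  - sgn F ((par a (+) par b) && (par c (+) par e)) *: (wgen c e * wgen a b).
transitivity (C a b c e - s a b *: C b a c e - s c e *: C a b e c + (s a b * s c e) *: C b a e c).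
  rewrite /C /wrot !(mulrBl, mulrBr) -!scalerAl -!scalerAr !(addbC (par b)) !(addbC (par e)).
  by linear_coefs (F : pzRingType); ring.
rewrite /C !wgen_comm /comm4 /wrot (metricC hg c a) (metricC hg c b) (metricC hg e a) (metricC hg e b).
have p1 := @metric_par _ _ _ _ hg c a; have p2 := @metric_par _ _ _ _ hg c b.
have p3 := @metric_par _ _ _ _ hg e a; have p4 := @metric_par _ _ _ _ hg e b.
rewrite /sg; linear_coefs (F : pzRingType).
all: by move: p1 p2 p3 p4; parity_cases; move=> p1 p2 p3 p4;
  try rewrite (p1 isT); try rewrite (p2 isT); try rewrite (p3 isT);
  try rewrite (p4 isT); ring.
Qed.

(** After normal ordering and a permutation of slots, each term is supersymmetric in two adjacent
    slots, because the [x] supercommute or because [g] is supersymmetric; an alternating tensor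
    annihilates it. *)
Lemma op4_alt (Q : tensor4) : alt4 Q -> op4 wrot Q = 0.
Proof.
move=> [q1 q2 q3]; rewrite /op4.
pose S (f : I -> I -> I -> I -> A) := sum4 (fun a b c e => Q a b c e *: f a b c e).
have S1 f : S (fun a b c e => s a b *: f b a c e) = - S f.
  rewrite /S sum4_swap12 -scaleN1r -sum4Z; apply: eq_sum4 => a b c e.
  by rewrite (q1 b a) !scalerA; congr (_ *: _); rewrite /sg; parity_cases; ring.
have S2 f : S (fun a b c e => s b c *: f a c b e) = - S f.
  rewrite /S sum4_swap23 -scaleN1r -sum4Z; apply: eq_sum4 => a b c e.
  by rewrite (q2 a c b) !scalerA; congr (_ *: _); rewrite /sg; parity_cases; ring.
have S3 f : S (fun a b c e => s c e *: f a b e c) = - S f.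
  rewrite /S sum4_swap34 -scaleN1r -sum4Z; apply: eq_sum4 => a b c e.
  by rewrite (q3 a b e) !scalerA; congr (_ *: _); rewrite /sg; parity_cases; ring.
have SD f h : S (fun a b c e => f a b c e + h a b c e) = S f + S h.
  by rewrite /S -sum4D; apply: eq_sum4 => *; rewrite scalerDr.
have SN f : S (fun a b c e => - f a b c e) = - S f.
  by rewrite /S -scaleN1r -sum4Z; apply: eq_sum4 => *; rewrite scalerN scaleN1r.
have eS f h : (forall a b c e, f a b c e = h a b c e) -> S f = S h.
  by move=> eq; apply: eq_sum4 => *; rewrite eq.
have z1 : S (fun a b c e => x a * x b * (d c * d e)) = 0.
  apply: eq_oppr_eq0; rewrite -S1; apply: eS => a b c e.
  by rewrite /= (xC a b) -scalerAl.
have z2 : S (fun a b c e => s b c *: (x a * x c * (d b * d e))) = 0.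
  by rewrite (S2 (fun a b c e => x a * x b * (d c * d e))) z1 oppr0.
have z3 : S (fun a b c e => g c b *: wgen a e) = 0.
  apply: eq_oppr_eq0; rewrite -S2; apply: eS => a b c e.
  by rewrite /= (metricC hg b c) scalerA.
have z4 : S (fun a b c e => wgen a b * wgen c e) = 0.
  rewrite (eS _ _ (fun a b c e => wgen_mul a b c e)) SD z2 z3 addr0 //.
have z5 : S (fun a b c e => wgen a b * wrot c e) = 0.
  rewrite (eS _ (fun a b c e => wgen a b * wgen c e + - (s c e *: (wgen a b * wgen e c)))).
    by rewrite SD SN (S3 (fun a b c e => wgen a b * wgen c e)) z4 !oppr0 addr0.
  by move=> *; rewrite /wrot mulrBr -scalerAr.
rewrite (_ : sum4 _ = S (fun a b c e => wrot a b * wrot c e)) //.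
rewrite (eS _ (fun a b c e => wgen a b * wrot c e + - (s a b *: (wgen b a * wrot c e)))).
  by rewrite SD SN (S1 (fun a b c e => wgen a b * wrot c e)) z5 !oppr0 addr0 scaler0.
by move=> *; rewrite {1}/wrot mulrBl -scalerAl.
Qed.

Lemma sum_metric_metric_r (V : lmodType F) (a : I) (f : I -> V) :
  \sum_b \sum_c g b c *: (g a c *: f b) = f a.
Proof.
under eq_bigr => b _.
  under eq_bigr => c _ do rewrite scalerA.
  rewrite -scaler_suml metricKr //.
over.
exact: sum_delta.
Qed.

Lemma sum_metric_metric_l (V : lmodType F) (a : I) (f : I -> V) :
  \sum_b \sum_c g b c *: (g a b *: f c) = sgn F (par a) *: f a.
Proof.
rewrite exchange_big /=; under eq_bigr => c _.
  under eq_bigr => b _ do rewrite scalerA mulrC.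
  rewrite -scaler_suml metric_mid //.
over.
rewrite -(sum_delta a (fun c => sgn F (par a) *: f c)); apply: eq_bigr => c _.
rewrite mulrC -scalerA eq_sym; case: eqP => [->//|]; by rewrite !scale0r.
Qed.

Let sum2_mull (u : A) (f : I -> I -> A) :
  u * (\sum_b \sum_c f b c) = \sum_b \sum_c u * f b c.
Proof. by rewrite mulr_sumr; apply: eq_bigr => b _; rewrite mulr_sumr. Qed.

Let sum2_mulr (u : A) (f : I -> I -> A) :
  (\sum_b \sum_c f b c) * u = \sum_b \sum_c f b c * u.
Proof. by rewrite mulr_suml; apply: eq_bigr => b _; rewrite mulr_suml. Qed.

Let sum2D (f h : I -> I -> A) :
  \sum_b \sum_c (f b c + h b c) = \sum_b \sum_c f b c + \sum_b \sum_c h b c.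
Proof. by rewrite -big_split; apply: eq_bigr => b _; rewrite -big_split. Qed.

Let eq_sum2 (f h : I -> I -> A) : (forall b c, (par b = par c) -> f b c = h b c) ->
  \sum_b \sum_c g b c *: f b c = \sum_b \sum_c g b c *: h b c.
Proof.
by move=> e; do 2![apply: eq_bigr => ? _]; apply: (metricZ_congr hg) => h'; apply: e.
Qed.

Let sum2Zl (u : A) (f : I -> I -> A) :
  u * (\sum_b \sum_c g b c *: f b c) = \sum_b \sum_c g b c *: (u * f b c).
Proof. by rewrite sum2_mull; do 2![apply: eq_bigr => ? _]; rewrite scalerAr. Qed.

Let sum2Zr (u : A) (f : I -> I -> A) :
  (\sum_b \sum_c g b c *: f b c) * u = \sum_b \sum_c g b c *: (f b c * u).
Proof. by rewrite sum2_mulr; do 2![apply: eq_bigr => ? _]; rewrite scalerAl. Qed.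

Let sum2ZD (f h : I -> I -> A) :
  \sum_b \sum_c g b c *: (f b c + h b c) =
  \sum_b \sum_c g b c *: f b c + \sum_b \sum_c g b c *: h b c.
Proof. by rewrite -sum2D; do 2![apply: eq_bigr => ? _]; rewrite scalerDr. Qed.

Lemma sgn_sg (a : I) : sgn F (par a) * s a a = 1.
Proof. by rewrite /sg; parity_cases; ring. Qed.

Lemma euler_x a : euler * x a = x a * euler + x a.
Proof.
rewrite -[X in _ + X](sum_metric_metric_r a x) /euler sum2Zl sum2Zr -sum2ZD.
apply: eq_sum2 => b c e.
rewrite -mulrA dx mulrDr -!scalerAr mulr1 !mulrA (xC b a) -scalerAl.
by rewrite /sg e; linear_coefs (F : pzRingType); parity_cases; ring.
Qed.

Lemma d_euler a : d a * euler = euler * d a + d a.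
Proof.
rewrite -[X in _ + X](sum_metric_metricT hg a d) /euler sum2Zl sum2Zr -sum2ZD.
apply: eq_sum2 => b c e.
rewrite mulrA dx mulrDl -!scalerAl mul1r -!mulrA (dC a c) -scalerAr.
by rewrite /sg e; linear_coefs (F : pzRingType); parity_cases; ring.
Qed.

Lemma radius_x a : radius * x a = x a * radius.
Proof.
rewrite /radius sum2Zl sum2Zr; apply: eq_sum2 => b c e.
rewrite -mulrA (xC c a) -scalerAr !mulrA (xC b a) -scalerAl.
by rewrite /sg e; linear_coefs (F : pzRingType); parity_cases; ring.
Qed.

Lemma laplace_d a : laplace * d a = d a * laplace.
Proof.
rewrite /laplace sum2Zl sum2Zr; apply: eq_sum2 => b c e.
rewrite -mulrA (dC c a) -scalerAr !mulrA (dC b a) -scalerAl.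
by rewrite /sg e; linear_coefs (F : pzRingType); parity_cases; ring.
Qed.

Lemma d_radius a : d a * radius = radius * d a + 2 *: x a.
Proof.
have -> : 2 *: x a = \sum_b \sum_c g b c *: (g c a *: (s a b *: x b)) +
    \sum_b \sum_c g b c *: (g b a *: x c).
  rewrite (sum_metric_metric hg a (fun b => s a b *: x b)) scalerA sgn_sg scale1r.
  by rewrite (sum_metric_metricT hg a x) scaler_nat mulr2n.
rewrite /radius sum2Zl sum2Zr -!sum2ZD; apply: eq_sum2 => b c e.
rewrite mulrA dx mulrDl -!scalerAl mul1r -(mulrA _ (d a)) dx mulrDr -!scalerAr mulr1 !mulrA.
by rewrite /sg e; linear_coefs (F : pzRingType); parity_cases; ring.
Qed.

Lemma laplace_x a : laplace * x a = x a * laplace + 2 *: d a.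
Proof.
have -> : 2 *: d a = \sum_b \sum_c g b c *: (g a b *: (s c a *: d c)) +
    \sum_b \sum_c g b c *: (g a c *: d b).
  rewrite (sum_metric_metric_l a (fun c => s c a *: d c)) scalerA sgn_sg scale1r.
  by rewrite (sum_metric_metric_r a d) scaler_nat mulr2n.
rewrite /laplace sum2Zl sum2Zr -!sum2ZD; apply: eq_sum2 => b c e.
rewrite -mulrA dx mulrDr -!scalerAr mulr1 (mulrA (d b) (x a)) dx mulrDl -!scalerAl mul1r !mulrA.
by rewrite /sg e; linear_coefs (F : pzRingType); parity_cases; ring.
Qed.

(** The commutant of the [sl2] spanned by [radius], [laplace] and a shifted [euler], in which the
    image of [osp] lies. *)
Definition sl2_invariant (u : A) : Prop :=
  [/\ u * euler = euler * u, u * radius = radius * u & u * laplace = laplace * u].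

Lemma wrot_invariant a b : sl2_invariant (wrot a b).
Proof.
have e1 i j : wgen i j * euler = euler * wgen i j.
  by rewrite /wgen -mulrA d_euler mulrDr !mulrA euler_x mulrDl.
have e2 i j : wgen i j * radius = radius * wgen i j + 2 *: (x i * x j).
  by rewrite /wgen -mulrA d_radius mulrDr -scalerAr !mulrA radius_x.
have e3 i j : wgen i j * laplace = laplace * wgen i j - 2 *: (d i * d j).
  by rewrite /wgen -mulrA -laplace_d !mulrA laplace_x mulrDl -scalerAl addrK.
rewrite /wrot; split; rewrite mulrBl mulrBr -scalerAl -scalerAr.
- by rewrite !e1.
- by rewrite !e2 (xC a b); linear_coefs (F : pzRingType); ring.
- by rewrite !e3 (dC a b); linear_coefs (F : pzRingType); ring.
Qed.

Lemma sl2_invariantD u v : sl2_invariant u -> sl2_invariant v -> sl2_invariant (u + v).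
Proof. by case=> a1 a2 a3 [b1 b2 b3]; split; rewrite mulrDl mulrDr ?a1 ?a2 ?a3 ?b1 ?b2 ?b3. Qed.
Lemma sl2_invariantZ k u : sl2_invariant u -> sl2_invariant (k *: u).
Proof. by case=> a1 a2 a3; split; rewrite -scalerAl -scalerAr ?a1 ?a2 ?a3. Qed.
Lemma sl2_invariantM u v : sl2_invariant u -> sl2_invariant v -> sl2_invariant (u * v).
Proof.
by case=> a1 a2 a3 [b1 b2 b3]; split; rewrite -mulrA ?b1 ?b2 ?b3 mulrA ?a1 ?a2 ?a3 mulrA.
Qed.
Lemma sl2_invariant1 : sl2_invariant 1. Proof. by split; rewrite mul1r mulr1. Qed.

Let w := 2 - M / 2.
(** Such operators send harmonic functions of degree [w] to multiples of [radius]. They do not form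
    an ideal, but invariant factors on either side can be moved past [radius], [laplace] and
    [euler]. *)
Definition harmonic_null (u : A) : Prop := exists p q r,
  u = radius * p + q * laplace + r * (euler - w *: 1).

Lemma harmonic_nullD u v : harmonic_null u -> harmonic_null v -> harmonic_null (u + v).
Proof.
move=> [p [q [r ->]]] [p' [q' [r' ->]]]; exists (p + p'), (q + q'), (r + r').
by move: (euler - _) => K; rewrite mulrDr !mulrDl addrACA [X in X + _]addrACA.
Qed.
Lemma harmonic_nullZ k u : harmonic_null u -> harmonic_null (k *: u).
Proof.
move=> [p [q [r ->]]]; exists (k *: p), (k *: q), (k *: r).
by move: (euler - _) => K; rewrite !scalerDr -!scalerAl -scalerAr.
Qed.
Lemma harmonic_null0 : harmonic_null 0.
Proof. by exists 0, 0, 0; rewrite mulr0 !mul0r !addr0. Qed.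
Lemma harmonic_nullMl u v : sl2_invariant u -> harmonic_null v -> harmonic_null (u * v).
Proof.
move=> [a1 a2 a3] [p [q [r ->]]]; exists (u * p), (u * q), (u * r).
by move: (euler - _) => K; rewrite !mulrDr !mulrA a2.
Qed.
Lemma harmonic_nullMr u v : sl2_invariant u -> harmonic_null v -> harmonic_null (v * u).
Proof.
move=> [a1 a2 a3] [p [q [r ->]]]; exists (p * u), (q * u), (r * u).
rewrite !mulrDl -!mulrA -a3; congr (_ + _ * _).
by rewrite mulrBl mulrBr a1 -scalerAl -scalerAr mul1r mulr1.
Qed.

Lemma wrot_mul a b c e : wrot a b * wrot c e =
  s b c *: (x a * x c * (d b * d e)) + g c b *: wgen a e
  - s c e *: (s b e *: (x a * x e * (d b * d c)) + g e b *: wgen a c)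
  - s a b *: (s a c *: (x b * x c * (d a * d e)) + g c a *: wgen b e)
  + (s a b * s c e) *: (s a e *: (x b * x e * (d a * d c)) + g e a *: wgen b c).
Proof.
rewrite /wrot mulrBl !mulrBr -!scalerAl -!scalerAr !wgen_mul.
by linear_coefs (F : pzRingType); ring.
Qed.

Lemma euler_flip : euler = \sum_b \sum_c g b c *: (s b c *: (x c * d b)).
Proof.
rewrite /euler exchange_big; do 2![apply: eq_bigr => ? _].
by rewrite (metricC hg) scalerA mulrC.
Qed.

Lemma Lsq_wrot a e : Lsq g wrot a e =
  x a * euler * d e + M *: wgen a e - x a * x e * laplace - wgen a e - radius * (d a * d e)
  - wgen a e + s a e *: (x e * euler * d a) + g e a *: euler.
Proof.
have t4 : \sum_b \sum_c g b c *: (g e b *: (s c e *: wgen a c)) = wgen a e.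
  by rewrite (sum_metric_metric_l e (fun c => s c e *: wgen a c)) scalerA sgn_sg scale1r.
have t6 : \sum_b \sum_c g b c *: (g c a *: (s a b *: wgen b e)) = wgen a e.
  by rewrite (sum_metric_metric hg a (fun b => s a b *: wgen b e)) scalerA sgn_sg scale1r.
have t2 : \sum_b \sum_c g b c *: (g c b *: wgen a e) = M *: wgen a e.
  rewrite -(metric_trace hg) scaler_suml; apply: eq_bigr => b _; rewrite scaler_suml.
  by apply: eq_bigr => c _; rewrite scalerA.
have sumN f : - (\sum_b \sum_c g b c *: f b c) = \sum_b \sum_c g b c *: (- f b c) :> A.
  by rewrite -sumrN; apply: eq_bigr => b _; rewrite -sumrN; apply: eq_bigr => c _; rewrite scalerN.
have sumZ k f : k *: (\sum_b \sum_c g b c *: f b c) = \sum_b \sum_c g b c *: (k *: f b c) :> A.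
  rewrite scaler_sumr; apply: eq_bigr => b _; rewrite scaler_sumr; apply: eq_bigr => c _.
  by rewrite !scalerA mulrC.
rewrite -t2 -[in X in _ - X - radius * _]t4 -[in X in _ - X + _ + _]t6 {1}euler_flip /laplace /radius /euler.
rewrite !(sum2Zl, sum2Zr, sumN, sumZ) -!sum2ZD; apply: eq_sum2 => b c h.
rewrite wrot_mul (xC b e) (dC a c) -!(scalerAl, scalerAr) /wgen !mulrA.
have p := @metric_par _ _ _ _ hg e a.
rewrite /sg h; linear_coefs (F : pzRingType).
all: by move: p; parity_cases; move=> p; try rewrite (p isT); ring.
Qed.

(** Moving [euler] to the right past a derivative gives [x_a d_e] the coefficient
    [2 (E - 1) + (M - 2) = 2 (E - w)]. The metric term [2 g_ea E] becomes a multiple of the same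
    factor once [2 w g_ea] is subtracted. This is where [w = 2 - M/2] comes from. *)
Lemma Lsq_wrot_sym a e :
  harmonic_null (Lsq g wrot a e + s a e *: Lsq g wrot e a - (2 * w * g e a) *: 1).
Proof.
exists (- 2 *: (d a * d e)), (- 2 *: (x a * x e)), (2 *: (wgen a e + s a e *: wgen e a) + (2 * g e a) *: 1).
have ed i : euler * d i = d i * euler - d i by rewrite d_euler addrK.
rewrite !Lsq_wrot -!(mulrA _ euler) !ed (xC e a) (dC e a) (metricC hg e a) /w.
rewrite /wgen !(mulrBr, mulrDl, mulrDr, =^~ scalerAl, =^~ scalerAr) !mulr1 !mul1r !mulrA.
rewrite /sg; linear_coefs (F : pzRingType).
all: by parity_cases; field.
Qed.
End WeylRealization.

(** * Evaluation of tensors *)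

Section Evaluation.
Variables (F : numClosedFieldType) (m n : nat).
Local Notation I := 'I_(m + n.*2).
Local Notation tensor4 := (I -> I -> I -> I -> F).
Local Notation TA := (talg F m n).
Variables (A : algType F) (L : I -> I -> A).

(** The part of degree [2 k]: letters are consumed in pairs [(a, b)], each replaced by half of
    [L a b]. Working degree by degree avoids any finiteness condition on [t]. *)
Fixpoint heval (k : nat) (t : seq I -> F) : A :=
  if k is k'.+1
  then 2^-1 *: \sum_a \sum_b L a b * heval k' (fun r => t [:: a, b & r])
  else t [::] *: 1.

Lemma heval_eq k t u : t =1 u -> heval k t = heval k u.
Proof. by move=> e; congr heval; apply/funext. Qed.

Lemma heval_lin k c t u :
  heval k (fun r => c * t r + u r) = c *: heval k t + heval k u.
Proof.
elim: k t u => [|k IH] t u /=; first by rewrite scalerDl scalerA.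
rewrite scalerA mulrC -scalerA -scalerDr; congr (_ *: _).
rewrite scaler_sumr -big_split; apply: eq_bigr => a _ /=.
rewrite scaler_sumr -big_split; apply: eq_bigr => b _ /=.
by rewrite IH mulrDr scalerAr.
Qed.

Lemma heval0 k : heval k (fun _ => 0) = 0.
Proof.
elim: k => [|k IH] /=; first by rewrite scale0r.
by rewrite big1 ?scaler0 // => a _; rewrite big1 // => b _; rewrite IH mulr0.
Qed.

Definition even_tens (t : seq I -> F) := forall r, odd (size r) -> t r = 0.

(** The product cuts a word at every position; evenness of [t] discards the cuts through the middle
    of a pair. *)
Lemma heval_mul k (t u : TA) : even_tens t ->
  heval k (t * u : TA) = \sum_(i < k.+1) heval i t * heval (k - i) u.
Proof.
elim: k t => [|k IH] t ht.
  by rewrite big_ord1 /= -scalerAl -scalerAr mulr1 scalerA -[(t * u) [::]]/(tmulr t u [::]) tmulr_nil.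
rewrite big_ord_recl -[RHS]/(heval 0 t * heval k.+1 u
  + \sum_(i < k.+1) heval i.+1 t * heval (k - i) u) /=.
pose tt a b : TA := fun r => t [:: a, b & r].
have e a b : heval k (fun r => (t * u : TA) [:: a, b & r]) =
    t [::] *: heval k (fun r => u [:: a, b & r]) + \sum_(i < k.+1) heval i (tt a b) * heval (k - i) u.
  rewrite -IH; last by move=> r hr; apply: ht; rewrite /= negbK.
  rewrite -heval_lin; apply: heval_eq => r.
  rewrite -[LHS]/(tmulr t u [:: a, b & r]) 2!tmulr_cons.
  by rewrite (ht [:: a]) // mul0r add0r.
under eq_bigr => a _ do under eq_bigr => b _ do rewrite e mulrDr mulr_sumr -scalerAr.
under eq_bigr => a _ do rewrite big_split /= -scaler_sumr.
rewrite big_split /= -scaler_sumr scalerDr scalerA mulrC -scalerA; congr (_ + _).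
  by rewrite -scalerAl mul1r.
under eq_bigr => a _ do rewrite exchange_big.
rewrite exchange_big /= scaler_sumr; apply: eq_bigr => i _.
rewrite -scalerAl mulr_suml; congr (_ *: _); apply: eq_bigr => a _.
by rewrite mulr_suml; apply: eq_bigr => b _; rewrite mulrA.
Qed.

(* The polynomial variable records half the tensor degree, so that the product of
   tensors becomes the product of polynomials. *)
Definition evaluates (t : seq I -> F) (p : {poly A}) : Prop :=
  even_tens t /\ forall k, p`_k = heval k t.

Lemma evaluates_inj t p q : evaluates t p -> evaluates t q -> p = q.
Proof. by move=> [_ hp] [_ hq]; apply/polyP => k; rewrite hp hq. Qed.

Lemma evaluates_ext t u p : t =1 u -> evaluates t p -> evaluates u p.
Proof. by move=> /funext ->. Qed.

(** Polynomials over [A] are scaled by elements of [A], so a scalar of [F] enters as [c *: 1]. *)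
Lemma evaluates_lin c t u p q : evaluates t p -> evaluates u q ->
  evaluates (fun r => c * t r + u r) ((c *: (1 : A)) *: p + q).
Proof.
move=> [ht hp] [hu hq]; split=> [r hr|k]; first by rewrite ht ?hu ?mulr0 ?addr0.
by rewrite coefD coefZ hp hq heval_lin -scalerAl mul1r.
Qed.

Lemma evaluates0 : evaluates (fun _ => 0) 0.
Proof. by split=> // k; rewrite coef0 heval0. Qed.

Lemma evaluatesD t u p q : evaluates t p -> evaluates u q ->
  evaluates (@tadd F m n t u) (p + q).
Proof.
move=> ht hu; have := evaluates_lin 1 ht hu; rewrite scale1r scale1r.
by apply: evaluates_ext => r; rewrite mul1r.
Qed.

Lemma evaluatesZ c t p : evaluates t p ->
  evaluates (@tscale F m n c t) ((c *: (1 : A)) *: p).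
Proof.
move=> ht; have := evaluates_lin c ht evaluates0; rewrite addr0.
by apply: evaluates_ext => r; rewrite addr0.
Qed.

Lemma evaluatesM t u p q : evaluates t p -> evaluates u q ->
  evaluates (@tmul F m n t u) (p * q).
Proof.
move=> [ht hp] [hu hq]; split=> [r hr|k].
  rewrite /tmul big1 // => i _.
  have := congr1 odd (congr1 size (cat_take_drop i r)); rewrite size_cat oddD hr.
  by case ho: (odd (size (take i r))) => /= h2; [rewrite ht ?mul0r|rewrite hu ?mulr0].
rewrite coefM -[tmul t u]/((t : TA) * u) heval_mul //.
by apply: eq_bigr => i _; rewrite hp hq.
Qed.

Lemma evaluates1 : evaluates (@tone F m n) 1.
Proof.
split=> [[]//|[|k]]; rewrite coef1 /= ?scale1r //.
rewrite big1 ?scaler0 // => a _; rewrite big1 // => b _.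
by rewrite heval0 mulr0.
Qed.

Definition op2 (X : I -> I -> F) : A := 2^-1 *: \sum_a \sum_b X a b *: L a b.

Lemma evaluates_emb2 X : evaluates (@emb2 F m n X) (op2 X *: 'X).
Proof.
split=> [[|? [|? [|? ?]]]//|[|[|k]]]; rewrite coefZ coefX /= ?mulr0 ?mulr1 ?scale0r //.
  by congr (_ *: _); do 2![apply: eq_bigr => ? _]; rewrite -scalerAr mulr1.
rewrite big1 ?scaler0 // => a _; rewrite big1 // => b _.
rewrite big1 ?scaler0 ?mulr0 // => a' _; rewrite big1 // => b' _.
by rewrite heval0 mulr0.
Qed.

Lemma evaluates_emb4 T : evaluates (@emb4 F m n T) (op4 L T *: 'X^2).
Proof.
split=> [[|? [|? [|? [|? [|? ?]]]]]//|[|[|[|k]]]]; rewrite coefZ coefXn /= ?mulr0 ?mulr1 ?scale0r //.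
- rewrite big1 ?scaler0 // => a _; rewrite big1 // => b _.
  by rewrite mulr0.
- rewrite /op4 /sum4 (_ : 4^-1 = 2^-1 * 2^-1); last by field.
  rewrite -scalerA; congr (_ *: _); rewrite scaler_sumr; apply: eq_bigr => a _.
  rewrite scaler_sumr; apply: eq_bigr => b _; rewrite -scalerAr mulr_sumr.
  congr (_ *: _); apply: eq_bigr => c _; rewrite mulr_sumr; apply: eq_bigr => e _.
  by rewrite -!scalerAr mulr1.
rewrite big1 ?scaler0 // => a _; rewrite big1 // => b _.
rewrite big1 ?scaler0 ?mulr0 // => a' _; rewrite big1 // => b' _.
rewrite big1 ?scaler0 ?mulr0 // => a2 _; rewrite big1 // => b2 _.
by rewrite heval0 mulr0.
Qed.

(** Although [A] is not commutative, the point 1 is central; evaluating there forgets the grading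
    and keeps products. *)
Lemma horner1M (p q : {poly A}) : (p * q).[1] = p.[1] * q.[1].
Proof. by rewrite hornerM_comm // /comm_poly mulr1 mul1r. Qed.

Lemma op2M X Y : op2 X * op2 Y = op4 L (fun a b c e => X a b * Y c e).
Proof.
rewrite /op2 /op4 -scalerAl -scalerAr scalerA (_ : 2^-1 * 2^-1 = 4^-1); last by field.
congr (_ *: _); rewrite mulr_suml; apply: eq_bigr => a _.
rewrite mulr_suml; apply: eq_bigr => b _; rewrite mulr_sumr; apply: eq_bigr => c _.
by rewrite mulr_sumr; apply: eq_bigr => e _; rewrite -scalerAl -scalerAr scalerA.
Qed.

Lemma op4_lin c (T U : tensor4) :
  op4 L (fun i j k l => c * T i j k l + U i j k l) = c *: op4 L T + op4 L U.
Proof.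
rewrite /op4 scalerA (mulrC c 4^-1) -scalerA -scalerDr; congr (_ *: _); rewrite -sum4Z -sum4D.
by apply: eq_sum4 => *; rewrite scalerDl scalerA.
Qed.
End Evaluation.

(** * Elements of the Joseph ideal evaluate to [null] elements *)

Section JosephRepresentation.
Variables (F : numClosedFieldType) (m n : nat).
Local Notation I := 'I_(m + n.*2).
Local Notation tensor4 := (I -> I -> I -> I -> F).
Variable g : I -> I -> F.
Hypothesis hg : is_osp_metric g.
Local Notation s := (sg F).
Local Notation M := (sdim F m n).
Variables (A : algType F) (L : I -> I -> A).
Hypothesis LC : forall a b, L a b = - (s a b *: L b a).
Hypothesis Lcomm : forall a b c e, L a b * L c e
  - sgn F ((par a (+) par b) && (par c (+) par e)) *: (L c e * L a b) = comm4 g L a b c e.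
Hypothesis Lalt : forall Q : tensor4, alt4 Q -> op4 L Q = 0.
Variables (inv null : A -> Prop).
Hypotheses (inv1 : inv 1) (invL : forall a b, inv (L a b))
  (invD : forall u v, inv u -> inv v -> inv (u + v))
  (invZ : forall k u, inv u -> inv (k *: u))
  (invM : forall u v, inv u -> inv v -> inv (u * v)).
Hypotheses (null0 : null 0)
  (nullD : forall u v, null u -> null v -> null (u + v))
  (nullZ : forall k u, null u -> null (k *: u))
  (nullMl : forall u v, inv u -> null v -> null (u * v))
  (nullMr : forall u v, inv u -> null v -> null (v * u)).
Variable lam : F.
Hypothesis hM1 : M != 1.
Hypothesis Lsq_sym : forall a e, null (Lsq g L a e + s a e *: Lsq g L e a
   - (4 * lam * (M - 1) * g e a) *: 1).

Let invS (T : Type) (r : seq T) (f : T -> A) :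
  (forall i, inv (f i)) -> inv (\sum_(i <- r) f i).
Proof.
move=> h; elim/big_rec: _ => [|i x _ hx]; last exact: invD.
by rewrite -(scale0r (1 : A)); apply: invZ.
Qed.

Let nullS (T : Type) (r : seq T) (f : T -> A) :
  (forall i, null (f i)) -> null (\sum_(i <- r) f i).
Proof. by move=> h; elim/big_rec: _ => [|i x _ hx] //; apply: nullD. Qed.

Lemma inTg_evaluates t : inTg t -> exists p, evaluates L t p /\ inv p.[1].
Proof.
elim=> {t} [|X hX|t u _ [p [hp ip]] _ [q [hq iq]]|c t _ [p [hp ip]]|t u _ [p [hp ip]] _ [q [hq iq]]|t u e _ [p [hp ip]]].
- by exists 1; split; [apply: evaluates1|rewrite hornerC].
- exists (op2 L X *: 'X); split; first exact: evaluates_emb2.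
  rewrite hornerZ hornerX mulr1; apply: invZ.
  by do 2![apply: invS => ?]; apply: invZ.
- by exists (p + q); split; [apply: evaluatesD|rewrite hornerD; apply: invD].
- exists ((c *: (1 : A)) *: p); split; first exact: evaluatesZ.
  by rewrite hornerZ -scalerAl mul1r; apply: invZ.
- by exists (p * q); split; [apply: evaluatesM|rewrite horner1M; apply: invM].
- by exists p; split=> //; apply: evaluates_ext e hp.
Qed.

(** By the antisymmetries of [T] the four terms of [comm4] contribute the same sum, which cancels
    the factor 1/4. *)
Lemma op4_comm (T : tensor4) : in_gg T ->
  op4 L T - op4 L (swap4 T) = \sum_a \sum_b \sum_c \sum_d T a b c d *: (g c b *: L a d).
Proof.
move=> [h1 h2]; pose S := sum4 (fun a b c d => T a b c d *: (g c b *: L a d)).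
rewrite -[RHS]/S.
have eS f : (forall a b c d, f a b c d = T a b c d *: (g c b *: L a d)) -> sum4 f = S.
  by move=> h; apply: eq_sum4.
have s1 : sum4 (fun a b c d => T a b c d *: ((s a b * g c a) *: L b d)) = - S.
  rewrite sum4_swap12 -scaleN1r -sum4Z; apply: eq_sum4 => a b c d.
  by rewrite (h1 b a); linear_coefs (F : pzRingType); rewrite /sg; parity_cases; ring.
have s2 : sum4 (fun a b c d => T a b c d *: ((s c d * g d b) *: L a c)) = - S.
  rewrite sum4_swap34 -scaleN1r -sum4Z; apply: eq_sum4 => a b c d.
  by rewrite (h2 a b d); linear_coefs (F : pzRingType); rewrite /sg; parity_cases; ring.
have s3 : sum4 (fun a b c d => T a b c d *: ((s a b * s c d * g d a) *: L b c)) = S.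
  rewrite sum4_swap34 sum4_swap12; apply: eq_sum4 => a b c d.
  by rewrite (h2 b a d) (h1 b a); linear_coefs (F : pzRingType); rewrite /sg; parity_cases; ring.
have -> : op4 L (swap4 T) = 4^-1 *: sum4 (fun a b c d => T a b c d *:
    (sgn F ((par a (+) par b) && (par c (+) par d)) *: (L c d * L a b))).
  rewrite /op4 sum4_swap23 sum4_swap12 sum4_swap34 sum4_swap23; congr (_ *: _).
  apply: eq_sum4 => a b c d; rewrite /swap4 andbC.
  by linear_coefs (F : pzRingType); ring.
rewrite /op4 -scalerBr.
transitivity (4^-1 *: (S - sum4 (fun a b c d => T a b c d *: ((s a b * g c a) *: L b d))
  - sum4 (fun a b c d => T a b c d *: ((s c d * g d b) *: L a c))
  + sum4 (fun a b c d => T a b c d *: ((s a b * s c d * g d a) *: L b c)))).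
  congr (_ *: _); rewrite /S -!scaleN1r -!sum4Z -!sum4D; apply: eq_sum4 => a b c d.
  rewrite scaleN1r -scalerBr Lcomm /comm4.
  by linear_coefs (F : pzRingType); ring.
by rewrite s1 s2 s3; move: (S) => y; linear_coefs (F : pzRingType); field.
Qed.

Lemma op2_bracket p q X Y : in_g X -> in_g Y -> homog p X -> homog q Y ->
  op2 L (bracket g p q X Y) =
  \sum_a \sum_b \sum_c \sum_d (X a b * Y c d) *: (g c b *: L a d).
Proof.
move=> hX hY pX pY.
pose S := sum4 (fun a b c d => (X a b * Y c d) *: (g c b *: L a d)).
have eS : sum4 (fun a b c d => (sgn F (p && q) * (Y a c * g d c * X d b)) *: L a b) = - S.
  transitivity (sum4 (fun a b c d => (sgn F (p && q) * (Y d c * g b c * X b a)) *: L d a)).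
    by rewrite [RHS]sum4_swap12 [RHS]sum4_swap34 [RHS]sum4_swap23 [RHS]sum4_swap12
      [RHS]sum4_swap23 [RHS]sum4_swap34.
  rewrite /S -scaleN1r -sum4Z; apply: eq_sum4 => a b c d.
  rewrite (LC d a) (hX b a) (hY d c) (metricC hg c b).
  linear_coefs (F : pzRingType).
  case: (eqVneq (X a b) 0) => [->|/pX <-]; first by ring.
  case: (eqVneq (Y c d) 0) => [->|/pY <-]; first by ring.
  have p1 := @metric_par _ _ _ _ hg c b; rewrite /sg.
  by move: p1; parity_cases; move=> p1; try rewrite (p1 isT); ring.
rewrite /op2 -[RHS]/S; transitivity (2^-1 *: (S - sum4 (fun a b c d => (sgn F (p && q) * (Y a c * g d c * X d b)) *: L a b))).
  congr (_ *: _); rewrite /S sum4_swap34 sum4_swap23 -scaleN1r -sum4Z -sum4D.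
  do 2![apply: eq_bigr => ? _]; rewrite /bracket scaler_suml; apply: eq_bigr => ? _.
  rewrite scaler_suml; apply: eq_bigr => ? _.
  by linear_coefs (F : pzRingType); ring.
by rewrite eS; move: (S) => y; linear_coefs (F : pzRingType); field.
Qed.

Lemma op4_swap_homog p q X Y : homog p X -> homog q Y ->
  op4 L (swap4 (fun a b c d => X a b * Y c d)) = sgn F (p && q) *: (op2 L Y * op2 L X).
Proof.
move=> pX pY; rewrite op2M -[RHS]addr0; have <- : op4 L (fun _ _ _ _ => 0) = 0.
  by rewrite /op4 /sum4 big1 ?scaler0 // => i _; do 3![rewrite big1 // => ? _]; rewrite scale0r.
rewrite -op4_lin; congr op4.
apply/funext => i; apply/funext => j; apply/funext => k; apply/funext => l.
rewrite /swap4 addr0.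
case: (eqVneq (X k l) 0) => [->|/pX <-]; first by ring.
case: (eqVneq (Y i j) 0) => [->|/pY <-]; first by ring.
by rewrite andbC; ring.
Qed.

Lemma in_g_tensor (X Y : I -> I -> F) : in_g X -> in_g Y ->
  in_gg (fun a b c d => X a b * Y c d).
Proof. by move=> hX hY; split=> a b c d; [rewrite (hX a b)|rewrite (hY c d)]; ring. Qed.

Lemma relU_evaluates t : Defs.relU g t -> exists p, evaluates L t p /\ p.[1] = 0.
Proof.
move=> [p [q [X [Y [hX hY pX pY ->]]]]].
eexists; split.
  apply: evaluatesD; last exact/evaluatesZ/evaluates_emb2.
  apply: evaluatesD; first by apply: evaluatesM; apply: evaluates_emb2.
  by apply/evaluatesZ/evaluatesM; apply: evaluates_emb2.
rewrite !(hornerD, hornerZ, hornerX, horner1M) !mulr1 op2_bracket // !mulr_algl.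
have := op4_comm (in_g_tensor hX hY).
rewrite (op4_swap_homog pX pY) -op2M => <-.
by linear_coefs (F : pzRingType); ring.
Qed.

Lemma null_phi S : sym2 S ->
  null (op4 L (phimap g S) - (lam * (M - 1) / 2 * tr2 g S) *: 1).
Proof.
(* The sum counts [op4 L (phimap g S)] eight times: four by [op4_phi] and twice by the
   symmetrization. *)
move=> hS; have h : null (8^-1 *: \sum_a \sum_e S a e *: (Lsq g L a e + s a e *: Lsq g L e a
   - (4 * lam * (M - 1) * g e a) *: 1)).
  by apply: nullZ; do 2![apply: nullS => ?]; apply: nullZ.
move: h; congr null; rewrite op4_phi //.
pose Q := \sum_a \sum_e S a e *: Lsq g L a e.
have e1 : \sum_a \sum_e S a e *: (s a e *: Lsq g L e a) = Q.
  rewrite exchange_big; apply: eq_bigr => x _; apply: eq_bigr => y _.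
  by rewrite scalerA mulrC [in RHS](hS x y) /sg andbC.
have e2 : \sum_a \sum_e S a e *: ((4 * lam * (M - 1) * g e a) *: (1 : A)) = (4 * lam * (M - 1) * tr2 g S) *: 1.
  rewrite /tr2 exchange_big mulr_sumr scaler_suml; apply: eq_bigr => a _ /=.
  rewrite mulr_sumr scaler_suml; apply: eq_bigr => e _.
  by linear_coefs (F : pzRingType); ring.
transitivity (8^-1 *: (Q + Q - (4 * lam * (M - 1) * tr2 g S) *: 1)).
  congr (_ *: _); rewrite -[in RHS]e2 -[in X in _ + X - _]e1 -big_split -sumrB.
  apply: eq_bigr => a _; rewrite -big_split -sumrB; apply: eq_bigr => e _ /=.
  by rewrite !(scalerDr, scalerN).
by rewrite -/Q; move: (Q) => y; linear_coefs (F : pzRingType); field.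
Qed.

(** Write [X (x) Y = V + q(U) + phi(S) + Z]. Symmetrization cancels [Z] and doubles [V], which the
    generator subtracts; [q(U)] acts by zero; the rest is twice the element of [null_phi]. *)
Lemma joseph_evaluates t : joseph_gen g lam t -> exists p, evaluates L t p /\ null p.[1].
Proof.
move=> [p [q [X [Y [V [[hX hY] pX pY [[hV tV _] [U [S [Z [hU hS hZ eT]]]]] ->]]]]]].
eexists; split.
  apply: evaluatesD.
    apply: evaluatesD; first by apply: evaluatesM; apply: evaluates_emb2.
    by apply/evaluatesZ/evaluatesM; apply: evaluates_emb2.
  apply: evaluatesD; first exact/evaluatesZ/evaluates_emb4.
  exact/evaluatesZ/evaluates1.
rewrite !(hornerD, hornerZ, hornerX, horner1M, hornerXn, hornerC) !expr1n !mulr1 !mulr_algl.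
pose T a b c e := X a b * Y c e.
have eT' : T = fun a b c e => 1 * V a b c e + (1 * qmap U a b c e + (1 * phimap g S a b c e + Z a b c e)).
  apply/funext => a; apply/funext => b; apply/funext => c; apply/funext => e.
  by rewrite -[T a b c e](subrK (V a b c e)) eT; ring.
have hq := alt4_q hU.
have hp := sym_phi hg hS.
have sw (W : tensor4) : sym_gg W -> swap4 W = W.
  by case=> _ h; do 4![apply/funext => ?]; rewrite /swap4 -h.
have swZ : swap4 Z = fun a b c e => (-1) * Z a b c e + 0.
  apply/funext => i; apply/funext => j; apply/funext => k; apply/funext => l.
  by rewrite /swap4 (hZ.2 i j k l); ring.
have eS : swap4 T = fun a b c e => 1 * V a b c e + (1 * qmap U a b c e + (1 * phimap g S a b c e + swap4 Z a b c e)).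
  rewrite -{1}(sw _ hV) -{1}(sw _ (alt4_sym hq)) -{1}(sw _ hp) eT'.
  by do 4![apply/funext => ?]; rewrite /swap4; ring.
rewrite -(op4_swap_homog pX pY) op2M -/T.
have fT : Defs.form g X Y = (M - 1) / 2 * tr2 g S.
  have tV' : tr4 g V = fun _ _ => 0 by do 2![apply/funext => ?]; apply: tV.
  have tq : tr4 g (qmap U) = fun _ _ => 0 by do 2![apply/funext => ?]; apply: alt4_tr.
  rewrite form_tr -/T eT'.
  have -> : tr4 g (fun a b c e => 1 * V a b c e + (1 * qmap U a b c e + (1 * phimap g S a b c e + Z a b c e)))
     = fun a b => 1 * tr4 g (phimap g S) a b + tr4 g Z a b.
    by do 2![apply/funext => ?]; rewrite !tr4_lin tV' tq; ring.
  by rewrite tr2_lin tr2_tr4_phi // (tr_asym hg hZ); ring.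
have -> : op4 L T + op4 L (swap4 T) + (- 2 *: op4 L V + - (2 * lam * Defs.form g X Y) *: 1)
    = 2 *: (op4 L (phimap g S) - (lam * (M - 1) / 2 * tr2 g S) *: 1).
  rewrite fT eS swZ [in X in X + _ + _]eT' !op4_lin (Lalt hq).
  have -> : op4 L (fun _ _ _ _ => 0) = 0.
    by rewrite /op4 /sum4 big1 ?scaler0 // => i _; do 3![rewrite big1 // => ? _]; rewrite scale0r.
  by linear_coefs (F : pzRingType); field.
exact/nullZ/null_phi.
Qed.

Lemma J1_evaluates t : J1 g lam t -> exists p, evaluates L t p /\ null p.[1].
Proof.
elim=> {t} [t [/relU_evaluates [p [hp e]]|/joseph_evaluates //]||t u _ [p [hp ip]] _ [q [hq iq]]|c t _ [p [hp ip]]|u t hu _ [p [hp ip]]|t u hu _ [p [hp ip]]|t u e _ [p [hp ip]]].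
- by exists p; rewrite e.
- by exists 0; split; [apply: evaluates0|rewrite horner0].
- by exists (p + q); split; [apply: evaluatesD|rewrite hornerD; apply: nullD].
- exists ((c *: (1 : A)) *: p); split; first exact: evaluatesZ.
  by rewrite hornerZ -scalerAl mul1r; apply: nullZ.
- have [q [hq iq]] := inTg_evaluates hu.
  by exists (q * p); split; [apply: evaluatesM|rewrite horner1M; apply: nullMl].
- have [q [hq iq]] := inTg_evaluates hu.
  by exists (p * q); split; [apply: evaluatesM|rewrite horner1M; apply: nullMr].
- by exists p; split=> //; apply: evaluates_ext e hp.
Qed.
End JosephRepresentation.

(** * A module of the Weyl superalgebra *)

Section Endomorphisms.
Variables (F : numClosedFieldType) (N : nat).
Local Notation I := 'I_N.
Local Notation K := {ffun I -> int}.

(** Coefficient families indexed by exponents, with no condition on the support, so that shifts act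
    without any side condition. *)
Definition wspace : Type := K -> F^o.
HB.instance Definition _ := GRing.Lmodule.copy wspace (K -> F^o).

Record endo := Endo {
  endo_fun :> wspace -> wspace;
  endo_lin : forall c u v, endo_fun (c *: u + v) = c *: endo_fun u + endo_fun v }.

HB.instance Definition _ := gen_eqMixin endo.
HB.instance Definition _ := gen_choiceMixin endo.

Lemma endo_ext (f h : endo) : (forall u, f u = h u) -> f = h.
Proof.
case: f h => f hf [h hh] /= e; have {}e : f = h by apply/funext.
by subst h; congr Endo; apply: Prop_irrelevance.
Qed.

Definition endo_add (f h : endo) : endo.
Proof.
by refine (@Endo (fun u => f u + h u) _) => c u v; rewrite !endo_lin scalerDr addrACA.
Defined.
Definition endo_opp (f : endo) : endo.
Proof.
by refine (@Endo (fun u => - f u) _) => c u v; rewrite endo_lin opprD scalerN.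
Defined.
Definition endo_zero : endo.
Proof. by refine (@Endo (fun _ => 0) _) => c u v; rewrite scaler0 addr0. Defined.
Definition endo_scale (k : F) (f : endo) : endo.
Proof.
refine (@Endo (fun u => k *: f u) _) => c u v.
by rewrite endo_lin scalerDr !scalerA mulrC.
Defined.
Definition endo_mul (f h : endo) : endo.
Proof. by refine (@Endo (fun u => f (h u)) _) => c u v; rewrite !endo_lin. Defined.
Definition endo_one : endo.
Proof. by refine (@Endo (fun u => u) _). Defined.

Lemma endo0 (f : endo) : f 0 = 0.
Proof. by have := endo_lin f (-1) 0 0; rewrite scaler0 addr0 scaleN1r addNr. Qed.

Lemma endo_addA : associative endo_add.
Proof. by move=> f h k; apply: endo_ext => u; apply: addrA. Qed.
Lemma endo_addC : commutative endo_add.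
Proof. by move=> f h; apply: endo_ext => u; apply: addrC. Qed.
Lemma endo_add0 : left_id endo_zero endo_add.
Proof. by move=> f; apply: endo_ext => u; apply: add0r. Qed.
Lemma endo_addN : left_inverse endo_zero endo_opp endo_add.
Proof. by move=> f; apply: endo_ext => u; apply: addNr. Qed.
HB.instance Definition _ := GRing.isZmodule.Build endo
  endo_addA endo_addC endo_add0 endo_addN.

Lemma endo_scaleA a b v : endo_scale a (endo_scale b v) = endo_scale (a * b) v.
Proof. by apply: endo_ext => u; apply: scalerA. Qed.
Lemma endo_scale1 : left_id 1 endo_scale.
Proof. by move=> f; apply: endo_ext => u; apply: scale1r. Qed.
Lemma endo_scaleDr : right_distributive endo_scale +%R.
Proof. by move=> a f h; apply: endo_ext => u; apply: scalerDr. Qed.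
Lemma endo_scaleDl v : {morph endo_scale^~ v : a b / a + b}.
Proof. by move=> a b; apply: endo_ext => u; apply: scalerDl. Qed.
HB.instance Definition _ := GRing.Zmodule_isLmodule.Build F endo
  endo_scaleA endo_scale1 endo_scaleDr endo_scaleDl.

Lemma endo_mulA : associative endo_mul.
Proof. by move=> f h k; apply: endo_ext. Qed.
Lemma endo_mul1l : left_id endo_one endo_mul.
Proof. by move=> f; apply: endo_ext. Qed.
Lemma endo_mul1r : right_id endo_one endo_mul.
Proof. by move=> f; apply: endo_ext. Qed.
Lemma endo_mulDl : left_distributive endo_mul +%R.
Proof. by move=> f h k; apply: endo_ext. Qed.
Lemma endo_mulDr : right_distributive endo_mul +%R.
Proof.
move=> f h k; apply: endo_ext => u /=.
by have := endo_lin f 1 (h u) (k u); rewrite !scale1r.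
Qed.
Lemma endo_one_neq0 : endo_one != 0.
Proof.
apply/eqP => /(congr1 (fun f : endo => (f (fun _ => 1) : wspace) 0)) /eqP.
exact/negP/oner_neq0.
Qed.
HB.instance Definition _ := GRing.Zmodule_isNzRing.Build endo
  endo_mulA endo_mul1l endo_mul1r endo_mulDl endo_mulDr endo_one_neq0.

Lemma endo_scaleAl (c : F) (f h : endo) : c *: (f * h) = (c *: f) * h.
Proof. by apply: endo_ext. Qed.
Lemma endo_scaleAr (c : F) (f h : endo) : c *: (f * h) = f * (c *: h).
Proof.
apply: endo_ext => u.
by have := endo_lin f c (h u) 0; rewrite endo0 !addr0 => e; rewrite [RHS]e.
Qed.
HB.instance Definition _ := GRing.Lmodule_isLalgebra.Build F endo endo_scaleAl.
HB.instance Definition _ := GRing.Lalgebra_isAlgebra.Build F endo endo_scaleAr.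

Lemma endoD (f h : endo) u : (f + h : endo) u = f u + h u. Proof. by []. Qed.
Lemma endoN (f : endo) u : (- f : endo) u = - f u. Proof. by []. Qed.
Lemma endoM (f h : endo) u : (f * h : endo) u = f (h u). Proof. by []. Qed.
Lemma endoZ c (f : endo) u : (c *: f : endo) u = c *: f u. Proof. by []. Qed.
Lemma endo_sum (T : Type) (r : seq T) (f : T -> endo) u :
  (\sum_(i <- r) f i : endo) u = \sum_(i <- r) f i u.
Proof. by elim/big_rec2: _ => // i x y _ <-. Qed.
Lemma wspace_sum (T : Type) (r : seq T) (f : T -> wspace) k :
  (\sum_(i <- r) f i) k = \sum_(i <- r) (f i k : F).
Proof. by elim/big_rec2: _ => // i x y _ <-. Qed.

Definition wshift (c : K -> F) (d : K) : endo.
Proof.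
refine (@Endo (fun u k => c k * u (k + d)) _) => a u v.
apply/funext => k; rewrite -[LHS]/(c k * (a * u (k + d) + v (k + d))).
by rewrite -[RHS]/(a * (c k * u (k + d)) + c k * v (k + d)) mulrDr mulrCA.
Defined.

Lemma wshiftE c d u k : wshift c d u k = c k * u (k + d). Proof. by []. Qed.

Lemma wshiftM c d c' d' :
  wshift c d * wshift c' d' = wshift (fun k => c k * c' (k + d)) (d + d').
Proof.
by apply: endo_ext => u; apply/funext => k; rewrite endoM !wshiftE addrA mulrA.
Qed.

Lemma wshift_lin a c c' d :
  a *: wshift c d + wshift c' d = wshift (fun k => a * c k + c' k) d.
Proof.
apply: endo_ext => u; apply/funext => k.
by rewrite -[LHS]/(a * (c k * u (k + d)) + c' k * u (k + d)) wshiftE mulrDl mulrA.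
Qed.

Lemma wshiftZ a c d : a *: wshift c d = wshift (fun k => a * c k) d.
Proof.
apply: endo_ext => u; apply/funext => k.
by rewrite -[LHS]/(a * (c k * u (k + d))) wshiftE mulrA.
Qed.

Lemma wshift1 : 1 = wshift (fun _ => 1) 0.
Proof.
by apply: endo_ext => u; apply/funext => k; rewrite wshiftE addr0 mul1r.
Qed.
End Endomorphisms.

(** * The Weyl superalgebra acting by weighted shifts of exponents *)

Section PolynomialModule.
Variables (F : numClosedFieldType) (m n : nat).
Local Notation I := 'I_(m + n.*2).
Local Notation K := {ffun I -> int}.
Local Notation s := (sg F).
Variables (u : I) (w : F).

Definition kdelta (b : I) : K := [ffun c => (b == c)%:R].

(** The Jordan-Wigner sign of moving [a] past the odd variables that precede it in the monomial; it
    makes operators of distinct odd variables anticommute. *)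
Definition ksign (a : I) (k : K) : F :=
  sgn F (par a && \big[addb/false]_(b : I | (b < a)%N && par b) odd (absz (k b))).
(* States are exponents in Z: the variable [u] is Laurent with exponents shifted by [w], the
   factor [z != 0] splits off the polynomials in the other even variables, and an odd
   variable only sees the parity of its exponent. *)
Definition xcoef (a : I) (z : int) : F :=
  if par a then (odd (absz (z)))%:R else if a == u then 1 else (z != 0)%:R.
Definition dcoef (a : I) (z : int) : F :=
  if par a then (~~ odd (absz (z)))%:R else (z + 1)%:~R + (if a == u then w else 0).
Definition xop (a : I) : endo F (m + n.*2) :=
  wshift (fun k => ksign a k * xcoef a (k a)) (- kdelta a).
Definition dop (a : I) : endo F (m + n.*2) :=
  wshift (fun k => ksign a k * dcoef a (k a)) (kdelta a).

Lemma odd_absz_addB1 (z : int) : (odd (absz ((z + 1)%R)) = ~~ odd (absz (z))) * (odd (absz ((z - 1)%R)) = ~~ odd (absz (z))).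
Proof. by split; lia. Qed.

Lemma ksign_shift a b (k : K) : (ksign a (k + kdelta b) = sgn F (par a && par b && (b < a)%N) * ksign a k)
  * (ksign a (k - kdelta b) = sgn F (par a && par b && (b < a)%N) * ksign a k).
Proof.
have key (e : K) : (forall c, odd (absz ((k + e) c)) = odd (absz (k c)) (+) (b == c)) ->
    ksign a (k + e) = sgn F (par a && par b && (b < a)%N) * ksign a k.
  move=> h; rewrite /ksign.
  under eq_bigr => c _ do rewrite h.
  rewrite big_split /=.
  set X := \big[addb/false]_(c | _) odd _.
  have -> : \big[addb/false]_(c : I | (c < a)%N && par c) (b == c) = par b && (b < a)%N.
    case: (boolP ((b < a)%N && par b)) => [hb|hb].
      rewrite (bigD1 b) //= eqxx big1 ?addbF; first by case/andP: hb => -> ->.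
      by move=> c /andP[_ /negbTE]; rewrite eq_sym.
    rewrite big1; first by case: (par b) hb; rewrite ?andbF // andbT => /negbTE ->.
    by move=> c hc; apply/eqP => e'; move: hb; rewrite e' hc.
  by case: (par a); case: (par b); case: (b < a)%N; case: X => /=; rewrite /sgn; ring.
by split; apply: key => c; rewrite !ffunE; case: (b == c) => /=; lia.
Qed.

Lemma kdelta_neq (a b : I) : a != b -> (kdelta a b = 0) * (kdelta b a = 0).
Proof. by move=> h; rewrite !ffunE (negbTE h) eq_sym (negbTE h). Qed.

Lemma ksign_sq a k : ksign a k * ksign a k = 1.
Proof. by rewrite /ksign; case: (_ && _); rewrite /sgn; ring. Qed.

Lemma kshiftE (k e : K) a : ((k - e) a = k a - e a) * ((k + e) a = k a + e a).
Proof. by rewrite !ffunE. Qed.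

(** Of two distinct odd indices exactly one precedes the other, so exactly one order of application
    produces the extra sign. *)
Lemma sg_order (a b : I) : a != b ->
  sgn F (par b && par a && (a < b)%N) = s a b * sgn F (par a && par b && (b < a)%N).
Proof.
rewrite -val_eqE /sg /= => h; case: (ltngtP a b) h => // _ _;
by parity_cases; ring.
Qed.

Lemma wshift_eq c c' d d' : (forall k, c k = c' k) -> d = d' ->
  wshift c d = wshift c' d' :> endo F (m + n.*2).
Proof. by move=> e ->; congr wshift; apply/funext. Qed.

Lemma xopC a b : xop a * xop b = s a b *: (xop b * xop a).
Proof.
rewrite /xop !wshiftM wshiftZ; apply: wshift_eq => [k|]; last exact: addrC.
case: (eqVneq a b) => [->|h].
  rewrite /sg /xcoef andbb; case: (par b); last by rewrite mul1r.
  rewrite kshiftE ffunE eqxx odd_absz_addB1.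
  by case: (odd _); rewrite /= !(mulr0, mul0r).
rewrite !ksign_shift (sg_order h) !kshiftE !(kdelta_neq h) !subr0.
ring.
Qed.

Lemma dopC a b : dop a * dop b = s a b *: (dop b * dop a).
Proof.
rewrite /dop !wshiftM wshiftZ; apply: wshift_eq => [k|]; last exact: addrC.
case: (eqVneq a b) => [->|h].
  rewrite /sg /dcoef andbb; case: (par b); last by rewrite mul1r.
  rewrite kshiftE ffunE eqxx odd_absz_addB1.
  by case: (odd _); rewrite /= !(mulr0, mul0r).
rewrite !ksign_shift (sg_order h) !kshiftE !(kdelta_neq h) !addr0.
ring.
Qed.

Lemma coef_comm a z : dcoef a z * xcoef a (z + 1) = s a a * (xcoef a z * dcoef a (z - 1)) + 1.
Proof.
rewrite /dcoef /xcoef /sg; case: (par a) => /=.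
  by rewrite !odd_absz_addB1; case: (odd _); rewrite /sgn /=; ring.
rewrite subrK /sgn; case: (a == u); first by rewrite rmorphD /=; ring.
have h (y : int) : y%:~R * (y != 0)%:R = y%:~R :> F.
  by case: (eqVneq y 0) => [->|_]; rewrite ?mulr0 ?mulr1.
by rewrite !addr0 h mul1r mulrC h rmorphD.
Qed.

Lemma dxop b c : dop b * xop c = s b c *: (xop c * dop b) + (b == c)%:R *: 1.
Proof.
rewrite /dop /xop !wshiftM wshiftZ.
case: (eqVneq b c) => [<-|h]; last first.
  rewrite scale0r addr0; apply: wshift_eq => [k|]; last exact: addrC.
  rewrite !ksign_shift (sg_order h) !kshiftE !(kdelta_neq h) subr0 addr0.
  ring.
rewrite scale1r wshift1 addrN addNr -[X in X + _]scale1r wshift_lin.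
apply: wshift_eq => // k; rewrite !ksign_shift ltnn andbF -[sgn F false]/(1 : F) !mul1r !kshiftE ffunE eqxx.
transitivity ((ksign b k * ksign b k) * (dcoef b (k b) * xcoef b (k b + 1))); first by ring.
rewrite coef_comm ksign_sq mul1r; congr (_ + _).
transitivity (s b b * ((ksign b k * ksign b k) * (xcoef b (k b) * dcoef b (k b - 1)))); last by ring.
by rewrite ksign_sq mul1r.
Qed.
End PolynomialModule.

(** * A normal form of the metric *)

Section NormalForm.
Variable F : numClosedFieldType.

(** The even part of the left factor is [(e + j a)(e - j t) / 2]. From [(e + j a)^2 = 2 j a] and
    [(e - j t)^2 = - 2 j t] it follows that it carries [t] to [a]. *)
Lemma congruence_normal (N : nat) (e o a b t : 'M[F]_N) (j : F) :
  j * j = -1 -> e *m t = t -> a *m a = e -> t *m t = e -> a *m e = a -> t *m e = t ->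
  e *m e = e -> e *m a = a -> o *m o = o ->
  a *m o = 0 -> o *m a = 0 -> t *m o = 0 -> o *m t = 0 -> e *m o = 0 -> o *m e = 0 ->
  o *m b = b -> b *m o = b -> a *m b = 0 -> b *m a = 0 -> t *m b = 0 -> b *m t = 0 ->
  e *m b = 0 -> b *m e = 0 ->
  (2^-1 *: (e + a *m t + j *: (a - t)) + o) *m (t + b)
    *m (2^-1 *: (e + t *m a + j *: (a - t)) + o) = a + b.
Proof.
move=> jj et aa tt ae te ee ea oo ao oa to ot eo oe ob bo ab ba tb bt eb be.
(* Products are associated to the right, so each multiplication rule is also needed in front of a
   further factor. *)
have R (x y z : 'M[F]_N) : x *m y = z -> forall v : 'M_N, x *m (y *m v) = z *m v.
  by move=> <- v; rewrite mulmxA.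
pose rules := (et, aa, tt, ae, te, ee, ea, oo, (ao, oa, to, ot, eo, oe), ob, bo,
  (ab, ba, tb, bt, eb, be), mulmx0, mul0mx).
pose rules' := (R _ _ _ et, R _ _ _ aa, R _ _ _ tt, R _ _ _ ae, R _ _ _ te, R _ _ _ ea,
  R _ _ _ ao, R _ _ _ oa, R _ _ _ to, R _ _ _ ot, (R _ _ _ ob, R _ _ _ bo, R _ _ _ eo),
  (R _ _ _ ab, R _ _ _ ba, R _ _ _ tb, R _ _ _ bt, R _ _ _ eb, R _ _ _ be)).
rewrite !(mulmxDl, mulmxDr, mulmxBl, mulmxBr, mulNmx, mulmxN, =^~ scalemxAl, =^~ scalemxAr).
rewrite -!mulmxA !(rules, rules').
linear_coefs (F : pzRingType).
all: by field: jj.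
Qed.

Variables (m n : nat).
Local Notation I := 'I_(m + n.*2).
Variable g : I -> I -> F.
Hypothesis hg : is_osp_metric g.

Let N := (m + n.*2)%N.
Let G : 'M[F]_N := \matrix_(i, j) g i j.
Let e : 'M[F]_N := diag_mx (\row_i (~~ par i)%:R).
Let o : 'M[F]_N := diag_mx (\row_i (par i)%:R).

Let e_o : e + o = 1%:M.
Proof.
by apply/matrixP => i j; rewrite !mxE; case: eqP => _; case: (par i); rewrite ?addr0 ?add0r.
Qed.

Let ee : e *m e = e.
Proof.
rewrite mulmx_diag; congr diag_mx; apply/rowP => i; rewrite !mxE.
by case: (par i); rewrite ?mulr0 ?mulr1.
Qed.

Let oE : o = 1%:M - e. Proof. by rewrite -e_o addrC addKr. Qed.
Let oe : o *m e = 0. Proof. by rewrite oE mulmxBl mul1mx ee subrr. Qed.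
Let eo : e *m o = 0. Proof. by rewrite oE mulmxBr mulmx1 ee subrr. Qed.
Let oo : o *m o = o. Proof. by rewrite {1}oE mulmxBl mul1mx eo subr0. Qed.
Let trE : e^T = e. Proof. exact: tr_diag_mx. Qed.
Let trO : o^T = o. Proof. exact: tr_diag_mx. Qed.

Let even_entries (X : 'M[F]_N) : e *m X = X *m e ->
  forall i j, par i != par j -> X i j = 0.
Proof.
move=> h i j; have := congr1 (fun Y : 'M_N => Y i j) h.
rewrite mul_diag_mx mul_mx_diag !mxE.
by case: (par i); case: (par j) => //=; rewrite ?mul0r ?mul1r ?mulr0 ?mulr1.
Qed.

Let entries_even (X : 'M[F]_N) : (forall i j, par i != par j -> X i j = 0) ->
  e *m X = X *m e.
Proof.
move=> h; apply/matrixP => i j; rewrite mul_diag_mx mul_mx_diag !mxE mulrC.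
case: (eqVneq (par i) (par j)) => [->//|ne]; by rewrite h // !mul0r.
Qed.

Let eG : e *m G = G *m e.
Proof. by apply: entries_even => i j ne; rewrite mxE metric_par. Qed.

Let GGt : G *m G^T = 1%:M.
Proof.
apply/matrixP => i j; rewrite !mxE eq_sym -(metricKr hg j i).
by apply: eq_bigr => k _; rewrite !mxE.
Qed.

Let eGt : e *m G^T = e *m G.
Proof.
apply/matrixP => i j; rewrite !mul_diag_mx !mxE (metricC hg i j) /sg.
by case: (par i); rewrite /= ?mul0r // /sgn mul1r.
Qed.

Variable f : I -> I.
Hypotheses (fK : involutive f) (fpar : forall i, par (f i) = par i).
Let T : 'M[F]_N := \matrix_(i, j) (f i == j)%:R.

Let TT : T *m T = 1%:M.
Proof.
apply/matrixP => i j; rewrite !mxE.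
under eq_bigr => k _ do rewrite !mxE.
by rewrite sum_deltaF fK.
Qed.

Let trT : T^T = T.
Proof. by apply/matrixP => i j; rewrite !mxE (can2_eq fK fK) eq_sym. Qed.

Let eT : e *m T = T *m e.
Proof.
apply: entries_even => i j ne; rewrite mxE; case: eqP => // h.
by rewrite -h fpar eqxx in ne.
Qed.

Let a := e *m G.
Let b := o *m G.
Let t := e *m T.
Let oG : o *m G = G *m o. Proof. by rewrite oE mulmxBl mulmxBr mul1mx mulmx1 eG. Qed.
Let oT : o *m T = T *m o. Proof. by rewrite oE mulmxBl mulmxBr mul1mx mulmx1 eT. Qed.

(* On the even part G^2 = T^2 = 1, so b(1 + iG) and b(1 + iT) with 2ib^2 = 1 are square roots
   for congruence of G^-1 and T^-1; [frame] is the first times the inverse of the second. *)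
Definition frame : 'M[F]_N := 2^-1 *: (e + a *m t + 'i *: (a - t)) + o.
Definition std_metric : 'M[F]_N := t + b.

Let tra : a^T = a.
Proof. by rewrite /a -[in LHS]eGt trmx_mul trmxK trE eG. Qed.
Let trt : t^T = t. Proof. by rewrite /t trmx_mul trE trT eT. Qed.
Let aa : a *m a = e.
Proof. by rewrite /a -{2}eGt !mulmxA -(mulmxA e G) -eG !mulmxA ee -(mulmxA e) GGt mulmx1. Qed.
Let tt : t *m t = e.
Proof. by rewrite /t !mulmxA -(mulmxA e T) -eT !mulmxA ee -(mulmxA e) TT mulmx1. Qed.
Let ae : a *m e = a. Proof. by rewrite /a -mulmxA -eG mulmxA ee. Qed.
Let te : t *m e = t. Proof. by rewrite /t -mulmxA -eT mulmxA ee. Qed.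
Let ea : e *m a = a. Proof. by rewrite /a mulmxA ee. Qed.
Let et : e *m t = t. Proof. by rewrite /t mulmxA ee. Qed.
Let ao : a *m o = 0. Proof. by rewrite /a -mulmxA -oG mulmxA eo mul0mx. Qed.
Let oa : o *m a = 0. Proof. by rewrite /a mulmxA oe mul0mx. Qed.
Let to : t *m o = 0. Proof. by rewrite /t -mulmxA -oT mulmxA eo mul0mx. Qed.
Let ot : o *m t = 0. Proof. by rewrite /t mulmxA oe mul0mx. Qed.
Let ob : o *m b = b. Proof. by rewrite /b mulmxA oo. Qed.
Let bo : b *m o = b. Proof. by rewrite /b -mulmxA -oG mulmxA oo. Qed.
Let eb : e *m b = 0. Proof. by rewrite /b mulmxA eo mul0mx. Qed.
Let be : b *m e = 0. Proof. by rewrite -bo -mulmxA oe mulmx0. Qed.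
Let ab : a *m b = 0. Proof. by rewrite -ob mulmxA ao mul0mx. Qed.
Let ba : b *m a = 0. Proof. by rewrite -bo -mulmxA oa mulmx0. Qed.
Let tb : t *m b = 0. Proof. by rewrite -ob mulmxA to mul0mx. Qed.
Let bt : b *m t = 0. Proof. by rewrite -bo -mulmxA ot mulmx0. Qed.

Lemma frame_tr : frame^T = 2^-1 *: (e + t *m a + 'i *: (a - t)) + o.
Proof.
have trD (X Y : 'M[F]_N) : (X + Y)^T = X^T + Y^T by apply: linearD.
have trN (X : 'M[F]_N) : (- X)^T = - X^T by apply: linearN.
have trZ c (X : 'M[F]_N) : (c *: X)^T = c *: X^T by apply: linearZ.
by rewrite /frame !(trD, trZ, trN) trmx_mul tra trt trE trO.
 Qed.

Lemma frameP : frame *m std_metric *m frame^T = G.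
Proof.
rewrite frame_tr /frame /std_metric.
rewrite (congruence_normal (e := e) (o := o)) //; last by rewrite -expr2 sqrCi.
by rewrite /a /b -mulmxDl e_o mul1mx.
Qed.

Lemma std_metricK : std_metric *m std_metric^T = 1%:M.
Proof.
have bb : b *m b^T = o.
  by rewrite trmx_mul trO /b !mulmxA -(mulmxA o G) GGt mulmx1 oo.
have tbt : t *m b^T = 0 by rewrite -trt -trmx_mul bt trmx0.
by rewrite /std_metric linearD /= trt mulmxDl !mulmxDr tt bt bb tbt addr0 add0r e_o.
Qed.

(** Coefficients of the derivatives dual to the new coordinates: [frame *m coframe^T] must be the
    metric for the Weyl relation to hold. *)
Definition coframe : 'M[F]_N := frame *m std_metric^T.

Lemma frame_coframe : frame *m coframe^T = G.
Proof. by rewrite /coframe trmx_mul trmxK mulmxA frameP. Qed.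

Lemma frame_dual : frame^T *m G *m coframe = 1%:M.
Proof.
have h : frame *m (coframe^T *m G^T) = 1%:M by rewrite mulmxA frame_coframe GGt.
have := mulmx1C h; move=> /(congr1 trmx).
by rewrite !trmx_mul !trmxK trmx1 mulmxA.
Qed.

Lemma frame_metric : frame^T *m G *m frame = std_metric.
Proof.
have := frame_dual; rewrite /coframe mulmxA => /(congr1 (fun X => X *m std_metric)).
by rewrite mul1mx -mulmxA (mulmx1C std_metricK) mulmx1.
Qed.

Lemma coframe_metric : coframe^T *m G *m coframe = std_metric.
Proof.
by rewrite -mulmxA /coframe trmx_mul trmxK -mulmxA mulmxA -(mulmxA std_metric)
  -/coframe (mulmxA frame^T) frame_dual mulmx1.
Qed.

Let even_std : e *m std_metric = std_metric *m e.
Proof. by rewrite /std_metric mulmxDr mulmxDl et te eb be. Qed.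

Let even_frame : e *m frame = frame *m e.
Proof.
rewrite /frame !(mulmxDr, mulmxDl, mulmxN, mulNmx, =^~ scalemxAl, =^~ scalemxAr).
by rewrite ee (mulmxA e a t) ea et eo -(mulmxA a t e) te ae oe.
Qed.

Lemma frame_even i j : par i != par j -> frame i j = 0.
Proof. exact: even_entries. Qed.

Lemma coframe_even i j : par i != par j -> coframe i j = 0.
Proof.
apply: even_entries; rewrite /coframe mulmxA even_frame -!mulmxA; congr (_ *m _).
by rewrite -{1}trE -trmx_mul -even_std trmx_mul trE.
Qed.

Lemma std_metric_even i j : par i = false -> f i != j -> std_metric i j = 0.
Proof.
move=> hi hj; rewrite mxE /t /b !mul_diag_mx !mxE hi mul0r addr0 /= mul1r.
by rewrite (negbTE hj).
Qed.
End NormalForm.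

(** * Infinite codimension *)

Section FrameOperators.
Variables (F : numClosedFieldType) (m n : nat).
Local Notation I := 'I_(m + n.*2).
Local Notation s := (sg F).
Variables (A : algType F) (y v : I -> A) (c : I -> I -> F) (P Q : I -> I -> F).
Hypotheses (Ppar : forall i j, par i != par j -> P i j = 0)
           (Qpar : forall i j, par i != par j -> Q i j = 0).

Lemma frame_mul (T : I -> I -> F) : \sum_a \sum_b T a b *: ((\sum_e P a e *: y e) * (\sum_f Q b f *: v f))
  = \sum_e \sum_f (\sum_a \sum_b P a e * T a b * Q b f) *: (y e * v f).
Proof.
transitivity (\sum_a \sum_b \sum_e \sum_f (P a e * T a b * Q b f) *: (y e * v f)).
  apply: eq_bigr => a _; apply: eq_bigr => b _.
  rewrite mulr_suml scaler_sumr; apply: eq_bigr => e _.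
  rewrite mulr_sumr scaler_sumr; apply: eq_bigr => f _.
  by rewrite -scalerAl -scalerAr; linear_coefs (F : pzRingType); ring.
under eq_bigr => a _ do rewrite exchange_big.
rewrite exchange_big; apply: eq_bigr => e _ /=.
under eq_bigr => a _ do rewrite exchange_big.
rewrite exchange_big; apply: eq_bigr => f _ /=.
by rewrite scaler_suml; apply: eq_bigr => a _; rewrite scaler_suml.
Qed.

Lemma frame_comm a b : (forall e f, y e * v f = s e f *: (v f * y e) + c e f *: 1) ->
  (\sum_e P a e *: y e) * (\sum_f Q b f *: v f) =
  s a b *: ((\sum_f Q b f *: v f) * (\sum_e P a e *: y e))
  + (\sum_e \sum_f P a e * Q b f * c e f) *: 1.
Proof.
move=> h; rewrite [X in s a b *: X]mulr_sumr mulr_suml scaler_suml scaler_sumr -big_split.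
apply: eq_bigr => e _ /=; rewrite mulr_sumr mulr_suml scaler_suml scaler_sumr -big_split.
apply: eq_bigr => f _ /=; rewrite -!scalerAl -!scalerAr h.
have -> : P a e = P a e * (par a == par e)%:R.
  by case: (eqVneq (par a) (par e)) => [_|/Ppar->]; rewrite ?mulr1 ?mul0r.
have -> : Q b f = Q b f * (par b == par f)%:R.
  by case: (eqVneq (par b) (par f)) => [_|/Qpar->]; rewrite ?mulr1 ?mul0r.
rewrite /sg; linear_coefs (F : pzRingType).
all: by parity_cases; ring.
Qed.
End FrameOperators.

(** * The functions [u^(w-j) z^j] *)

Section Module.
Variables (F : numClosedFieldType) (m n : nat).
Local Notation I := 'I_(m + n.*2).
Local Notation K := {ffun I -> int}.
Local Notation W := (wspace F (m + n.*2)).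
Variables (u z : I) (w : F).
Hypotheses (pu : par u = false) (pz : par z = false) (uz : u != z).
Local Notation X := (xop F u).
Local Notation D := (dop u w).

(** The exponents of [u^(w-j) z^j], with that of [u] stored relative to [w]. *)
Definition null_index (j : nat) : K := (kdelta z - kdelta u) *+ j.
Definition null_power (j : nat) : W := fun k => (k == null_index j)%:R.

Lemma null_indexE j b : null_index j b = (z == b)%:R *+ j - (u == b)%:R *+ j.
Proof. by rewrite /null_index ffunMnE !ffunE mulrnBl. Qed.

Lemma null_power_at j k (c c' : F) : (k = null_index j -> c = c') ->
  c * null_power j k = c' * null_power j k.
Proof. by rewrite /null_power; case: eqP => [e /(_ e) ->|_ _]; rewrite ?mulr0. Qed.

Lemma ksign_even (b : I) k : par b = false -> ksign F b k = 1.
Proof. by rewrite /ksign => ->. Qed.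

Lemma dop_null b j : b != u -> b != z -> D b (null_power j) = 0.
Proof.
move=> bu bz; apply/funext => k; rewrite wshiftE -[RHS](mul0r (null_power j (k + kdelta b))).
apply: null_power_at => /(congr1 (fun h : K => h b)).
rewrite null_indexE ![_ == b]eq_sym (negbTE bu) (negbTE bz) !mul0rn subr0 !ffunE eqxx => e.
(* A derivative in [b] reads the exponent 0 from position [-1], where its weight vanishes for both
   parities. *)
have -> : k b = -1 by apply/eqP; rewrite -subr_eq0 opprK; apply/eqP.
rewrite /dcoef (negbTE bu); case: (par b); first by rewrite mulr0.
by rewrite addNr addr0 mulr0.
Qed.

Lemma xop_at0 b (v : W) (k : K) : b != u -> k b = 0 -> X b v k = 0.
Proof.
move=> bu e; rewrite wshiftE e /xcoef (negbTE bu).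
by case: (par b); rewrite /= ?eqxx ?mulr0 mul0r.
Qed.

Lemma euler_null j : \sum_b X b (D b (null_power j)) = w *: null_power j.
Proof.
have zu : z != u by rewrite eq_sym.
transitivity (X u (D u (null_power j)) + X z (D z (null_power j))).
  rewrite (bigD1 u) // (bigD1 z) //; congr (_ + _); rewrite big1; first exact: addr0.
  by move=> b /andP[bu bz]; rewrite dop_null // endo0.
apply/funext => k.
rewrite -[LHS]/(X u (D u (null_power j)) k + X z (D z (null_power j)) k) !wshiftE !subrK.
rewrite !ksign_even // !mul1r !kshiftE !ffunE !eqxx /xcoef /dcoef pu pz eqxx (eq_sym z) (negbTE uz) !subrK.
rewrite mul1r addr0 mulrA -mulrDl -[RHS]/(w * null_power j k); apply: null_power_at => ->.
rewrite !null_indexE !eqxx (negbTE uz) (eq_sym z) (negbTE uz) !mul0rn subr0 sub0r.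
rewrite (_ : (1 *+ j != 0 :> int)%:R * (1 *+ j)%:~R = (1 *+ j)%:~R :> F).
  by rewrite rmorphN /=; ring.
by case: eqP => [->|_]; rewrite ?mulr0 ?mul1r.
Qed.

Lemma lower_null j : X u (D z (null_power j.+1)) = j.+1%:R *: null_power j.
Proof.
apply/funext => k; rewrite !wshiftE !ksign_even // !mul1r kshiftE (kdelta_neq uz) subr0.
rewrite /xcoef /dcoef pu pz eqxx (eq_sym z) (negbTE uz) mul1r addr0.
rewrite -[RHS]/(j.+1%:R * null_power j k).
have -> : null_power j.+1 (k - kdelta u + kdelta z) = null_power j k.
  rewrite /null_power /null_index mulrSr addrAC -addrA.
  by rewrite (inj_eq (addIr _)).
apply: null_power_at => ->; rewrite null_indexE eqxx (negbTE uz) mul0rn subr0.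
by rewrite -[true%:R]/(1 : int) -mulrSr natz -pmulrn.
Qed.

Lemma lower_null0 : X u (D z (null_power 0)) = 0.
Proof.
apply/funext => k; rewrite !wshiftE !ksign_even // !mul1r kshiftE (kdelta_neq uz) subr0.
rewrite /xcoef /dcoef pu pz eqxx (eq_sym z) (negbTE uz) mul1r addr0.
rewrite -[RHS](mul0r (null_power 0 (k - kdelta u + kdelta z))); apply: null_power_at.
move=> /(congr1 (fun h : K => h z)); rewrite !ffunE eqxx (negbTE uz) subr0 => e.
by rewrite [k z + 1]e.
Qed.

Lemma null_power_zero j : null_power j 0 = (j == 0%N)%:R.
Proof.
rewrite /null_power; congr (nat_of_bool _)%:R; apply/eqP/eqP => [|->]; last by rewrite /null_index mulr0n.
move=> /(congr1 (fun h : K => h z)); rewrite null_indexE ffunE eqxx (negbTE uz) mul0rn subr0.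
by move/esym/eqP; rewrite -[true%:R]/(1 : int) pnatr_eq0 => /eqP.
Qed.
End Module.

Section InfiniteCodimension.
(* Otherwise mxE would compute their entries. *)
#[local] Opaque frame coframe std_metric.
Variables (F : numClosedFieldType) (m n : nat).
Local Notation I := 'I_(m + n.*2).
Local Notation K := {ffun I -> int}.
Local Notation W := (wspace F (m + n.*2)).
Local Notation A := (endo F (m + n.*2)).
Local Notation s := (sg F).
Local Notation M := (sdim F m n).
Variable g : I -> I -> F.
Hypothesis hg : is_osp_metric g.
Hypothesis hm : (4 < m)%N.

Let bound k : (k < 4)%N -> (k < m + n.*2)%N.
Proof. by move=> h; apply: ltn_addr; apply: leq_trans hm; apply: leqW. Qed.
Let idx k (h : (k < 4)%N) : I := Ordinal (bound h).
Let par_idx k (h : (k < 4)%N) : par (idx h) = false.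
Proof. by apply/negbTE; rewrite /par /= -ltnNge; apply: leq_trans hm; apply: leqW. Qed.

Let u : I := idx (isT : (0 < 4)%N).
Let u' : I := idx (isT : (1 < 4)%N).
Let z : I := idx (isT : (2 < 4)%N).
Let z' : I := idx (isT : (3 < 4)%N).

(** The target even metric makes [u], [u'] and [z], [z'] hyperbolic pairs and keeps the other even
    coordinates orthonormal; [u] and [z] are thus null and orthogonal. *)
Let f (i : I) : I :=
  if i == u then u' else if i == u' then u else if i == z then z' else if i == z' then z else i.

Let fK : involutive f.
Proof.
move=> i; rewrite /f.
case: (eqVneq i u) => [->//|h1]; case: (eqVneq i u') => [->//|h2].
case: (eqVneq i z) => [->//|h3]; case: (eqVneq i z') => [->//|h4].
by rewrite (negbTE h1) (negbTE h2) (negbTE h3) (negbTE h4).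
Qed.

Let fpar i : par (f i) = par i.
Proof.
rewrite /f; case: (eqVneq i u) => [->|h1]; first by rewrite !par_idx.
case: (eqVneq i u') => [->|h2]; first by rewrite !par_idx.
case: (eqVneq i z) => [->|h3]; first by rewrite !par_idx.
by case: (eqVneq i z') => [->|h4]; first by rewrite !par_idx.
Qed.

Let P := frame g f.
Let C := coframe g f.
Let S := std_metric g f.
Let w := 2 - M / 2.
Local Notation X := (xop F u).
Local Notation D := (dop u w).

Definition xvar (a : I) : A := \sum_b P a b *: X b.
Definition dvar (a : I) : A := \sum_b C a b *: D b.

Let Ppar i j : par i != par j -> P i j = 0.
Proof. exact: frame_even. Qed.
Let Cpar i j : par i != par j -> C i j = 0.
Proof. exact: coframe_even. Qed.

Lemma xvarC a b : xvar a * xvar b = s a b *: (xvar b * xvar a).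
Proof.
rewrite /xvar (frame_comm (c := fun _ _ => 0) Ppar Ppar); last first.
  by move=> e k; rewrite scale0r addr0; apply: xopC.
rewrite (_ : \sum_e _ = 0) ?scale0r ?addr0 //.
by rewrite big1 // => e _; rewrite big1 // => k _; rewrite mulr0.
Qed.

Lemma dvarC a b : dvar a * dvar b = s a b *: (dvar b * dvar a).
Proof.
rewrite /dvar (frame_comm (c := fun _ _ => 0) Cpar Cpar); last first.
  by move=> e k; rewrite scale0r addr0; apply: dopC.
rewrite (_ : \sum_e _ = 0) ?scale0r ?addr0 //.
by rewrite big1 // => e _; rewrite big1 // => k _; rewrite mulr0.
Qed.

Lemma dxvar b c : dvar b * xvar c = s b c *: (xvar c * dvar b) + g c b *: 1.
Proof.
rewrite /dvar /xvar (frame_comm (c := fun e k => (e == k)%:R) Cpar Ppar); last first.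
  by move=> e k; apply: dxop.
congr (_ + _ *: _).
have /matrixP/(_ c b) := frame_coframe hg fK fpar; rewrite !mxE => <-.
apply: eq_bigr => e _; transitivity (P c e * C b e); last by rewrite ?mxE.
rewrite -[RHS](sum_deltaF e (fun k => P c k * C b e)).
by apply: eq_bigr => k _; ring.
Qed.

Let sum_entries (Q R : 'M[F]_(m + n.*2)) e k :
  \sum_a \sum_b Q a e * g a b * R b k = (Q^T *m (\matrix_(i, j) g i j) *m R) e k.
Proof.
rewrite !mxE exchange_big; apply: eq_bigr => b _; rewrite !mxE mulr_suml.
by apply: eq_bigr => a _; rewrite !mxE.
Qed.

Lemma euler_frame : euler g xvar dvar = \sum_b X b * D b.
Proof.
rewrite /euler frame_mul; apply: eq_bigr => e _.
rewrite -[RHS](sum_delta e (fun k => X e * D k)); apply: eq_bigr => k _.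
by rewrite sum_entries frame_dual // mxE.
Qed.

Lemma radius_frame : radius g xvar = \sum_e \sum_k S e k *: (X e * X k).
Proof.
rewrite /radius frame_mul; apply: eq_bigr => e _; apply: eq_bigr => k _.
by rewrite sum_entries frame_metric.
Qed.

Lemma laplace_frame : laplace g dvar = \sum_e \sum_k S e k *: (D e * D k).
Proof.
rewrite /laplace frame_mul; apply: eq_bigr => e _; apply: eq_bigr => k _.
by rewrite sum_entries coframe_metric.
Qed.

Let uz : u != z. Proof. by []. Qed.
Let pu : par u = false. Proof. exact: par_idx. Qed.
Let pz : par z = false. Proof. exact: par_idx. Qed.
Local Notation fj := (@null_power F m n u z).

Let S_uz e k : (e == u) || (e == z) -> (k == u) || (k == z) -> S e k = 0.
Proof.
move=> /orP[]/eqP-> /orP[]/eqP->; apply: std_metric_even => //; exact: par_idx.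
Qed.

Lemma euler_fj j : euler g xvar dvar (fj j) = w *: fj j.
Proof. by rewrite euler_frame endo_sum; apply: euler_null. Qed.

Lemma dop_fj b j : ~~ ((b == u) || (b == z)) -> D b (fj j) = 0.
Proof. by rewrite negb_or => /andP[bu bz]; apply: dop_null. Qed.

Lemma laplace_fj j : laplace g dvar (fj j) = 0.
Proof.
rewrite laplace_frame endo_sum big1 // => e _; rewrite endo_sum big1 // => k _.
rewrite endoZ endoM.
case: (boolP ((k == u) || (k == z))) => hk; last by rewrite dop_fj // endo0 scaler0.
case: (boolP ((e == u) || (e == z))) => he; first by rewrite S_uz // scale0r.
have -> : D e (D k (fj j)) = (D e * D k) (fj j) by [].
by rewrite dopC endoZ endoM dop_fj // endo0 !scaler0.
Qed.

(** Multiplication by a variable other than [u] never reaches exponent 0 in that variable. A term of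
    [radius] whose first factor is [u] has [u'] as its second. *)
Lemma radius_zero (v : W) : radius g xvar v 0 = 0.
Proof.
rewrite radius_frame endo_sum wspace_sum big1 // => e _.
rewrite endo_sum wspace_sum big1 // => k _.
rewrite -[LHS]/(S e k * X e (X k v) 0).
case: (eqVneq e u) => [->|eu]; last by rewrite xop_at0 ?mulr0 // ffunE.
case: (eqVneq (f u) k) => [<-|h]; last by rewrite /S std_metric_even ?mul0r.
rewrite -[X u _ 0]/(ksign F u 0 * xcoef F u u ((0 : K) u) * X (f u) v (0 - kdelta u)).
rewrite [X (f u) v _]xop_at0 ?mulr0 //.
by rewrite !ffunE.
Qed.

(** [q] recovers the operator [X u] from [xvar], and [r] recovers [D z] from [dvar]. Their
    super-antisymmetrization [Xg] is the element acting as [u d_z - z' d_u']. *)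
Let q a := \sum_b g a b * C b u.
Let r b := \sum_a P a z * g a b.

Let Xg (a b : I) : F := q a * r b - s a b * (q b * r a).

Let q_par a : par a -> q a = 0.
Proof.
move=> pa; rewrite /q big1 // => b _.
case: (boolP (par b)) => pb; first by rewrite Cpar ?mulr0 // pu pb.
by rewrite metric_par ?mul0r // pa (negbTE pb).
Qed.

Let Xg_in : in_g Xg.
Proof.
move=> a b; rewrite /Xg /sg [par b && par a]andbC.
by parity_cases; ring.
Qed.

Let L := wrot xvar dvar.

Lemma op2_Xg : op2 L Xg = X u * D z - (\sum_b r b *: xvar b) * (\sum_a q a *: dvar a).
Proof.
have LC := wrotC xvar dvar.
have -> : op2 L Xg = \sum_a \sum_b (q a * r b) *: L a b.
  rewrite /op2 -[RHS](_ : 2^-1 *: (\sum_a \sum_b (q a * r b) *: L a b + \sum_a \sum_b (q a * r b) *: L a b) = _); last first.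
    by move: (\sum_a _) => y; linear_coefs (F : pzRingType); field.
  congr (_ *: _); rewrite [in X in _ = _ + X]exchange_big -big_split; apply: eq_bigr => a _ /=.
  rewrite -big_split; apply: eq_bigr => b _ /=.
  rewrite /L (LC b a) /Xg /sg [par b && par a]andbC.
  by linear_coefs (F : pzRingType); parity_cases; ring.
have sumZ (v : I -> F) (T : I -> I -> F) (y : I -> A) :
    \sum_a v a *: (\sum_e T a e *: y e) = \sum_e (\sum_a v a * T a e) *: y e.
  under eq_bigr => a _ do rewrite scaler_sumr.
  rewrite exchange_big; apply: eq_bigr => e _; rewrite scaler_suml.
  by apply: eq_bigr => a _; rewrite scalerA.
have e1 : (\sum_a q a *: xvar a) = X u.
  rewrite sumZ -[RHS](sum_delta u X); apply: eq_bigr => e _; congr (_ *: _).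
  have /matrixP/(_ e u) := frame_dual hg fK fpar; rewrite -sum_entries [in RHS]mxE eq_sym => <-.
  apply: eq_bigr => a _; rewrite mulr_suml; apply: eq_bigr => b _; rewrite -/P -/C; ring.
have e2 : (\sum_b r b *: dvar b) = D z.
  rewrite sumZ -[RHS](sum_delta z D); apply: eq_bigr => e _; congr (_ *: _).
  have /matrixP/(_ z e) := frame_dual hg fK fpar; rewrite -sum_entries [in RHS]mxE => <-.
  by rewrite exchange_big; apply: eq_bigr => b _; rewrite mulr_suml.
transitivity (\sum_a \sum_b (q a * r b) *: (xvar a * dvar b)
    - \sum_a \sum_b (q a * r b) *: (xvar b * dvar a)).
  rewrite -sumrB; apply: eq_bigr => a _; rewrite -sumrB; apply: eq_bigr => b _.
  rewrite /L /wrot /wgen scalerBr; congr (_ - _).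
  case: (boolP (par a)) => pa; first by rewrite q_par // !mul0r !scale0r.
  by rewrite /sg (negbTE pa) scale1r.
rewrite -e1 -e2; congr (_ - _).
  rewrite mulr_suml; apply: eq_bigr => a _; rewrite mulr_sumr; apply: eq_bigr => b _.
  by rewrite -scalerAl -scalerAr scalerA.
rewrite exchange_big mulr_suml; apply: eq_bigr => b _; rewrite mulr_sumr.
by apply: eq_bigr => a _; rewrite -scalerAl -scalerAr scalerA mulrC.
Qed.

Lemma q_dvar_fj j : (\sum_a q a *: dvar a) (fj j) = 0.
Proof.
have -> : \sum_a q a *: dvar a = \sum_k S k u *: D k.
  under eq_bigr => a _ do rewrite scaler_sumr.
  rewrite exchange_big; apply: eq_bigr => k _.
  have /matrixP/(_ k u) := coframe_metric hg fK fpar; rewrite -sum_entries -/S => <-.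
  rewrite scaler_suml; apply: eq_bigr => a _; rewrite scalerA; congr (_ *: _).
  by rewrite mulr_suml; apply: eq_bigr => b _; rewrite -/C; ring.
rewrite endo_sum big1 // => k _; rewrite endoZ.
case: (boolP ((k == u) || (k == z))) => hk; last by rewrite dop_fj // scaler0.
by rewrite S_uz ?eqxx // scale0r.
Qed.

Lemma lower_fj j : op2 L Xg (fj j) = (X u * D z) (fj j).
Proof. by rewrite op2_Xg endoD endoN !endoM q_dvar_fj endo0 subr0. Qed.

(** Position 0 sees only [u^w], which is reached from [u^(w-j) z^j] after exactly [j] steps with
    accumulated factor [j!]. *)
Lemma lower_power i j : ((op2 L Xg) ^+ i) (fj j) 0 = ((i == j) * j`!)%:R :> F.
Proof.
elim: i j => [|i IH] j.
  by rewrite expr0 -[LHS]/(fj j 0) null_power_zero // eq_sym; case: j => [|j]; rewrite ?muln1.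
rewrite exprSr endoM lower_fj endoM; case: j => [|j].
  by rewrite lower_null0 // endo0.
rewrite lower_null //.
have -> : ((op2 L Xg) ^+ i) (j.+1%:R *: fj j) = j.+1%:R *: ((op2 L Xg) ^+ i) (fj j).
  by have := endo_lin ((op2 L Xg) ^+ i) j.+1%:R (fj j) 0; rewrite endo0 !addr0.
rewrite -[LHS]/(j.+1%:R * (((op2 L Xg) ^+ i) (fj j) 0 : F)) IH eqSS -natrM.
by rewrite factS mulnCA.
Qed.

Hypothesis hM1 : M != 1.

Lemma J1_infinite_codim : infinite_codim (J1 g (critical F m n)).
Proof.
move=> k; pose E : talg F m n := e2 Xg; exists (fun i => (E ^+ i : talg F m n)); split.
  move=> [i hi] /=; elim: i {hi} => [|i IH]; first exact: Tg_one.
  by rewrite exprS; apply: Tg_mul => //; apply: Tg_emb.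
move=> c hJ.
have hE i : evaluates L (E ^+ i : talg F m n) ((op2 L Xg *: 'X) ^+ i).
  elim: i => [|i IH]; first exact: evaluates1.
  by rewrite !exprS; apply: evaluatesM => //; apply: evaluates_emb2.
have hS : evaluates L (fun t => \sum_(i < k) c i * (E ^+ i : talg F m n) t)
    (\sum_(i < k) (c i *: (1 : A)) *: (op2 L Xg *: 'X) ^+ i).
  elim: (index_enum _) => [|i l IH].
    rewrite big_nil; apply: evaluates_ext (evaluates0 L) => t.
    by rewrite big_nil.
  rewrite big_cons; apply: evaluates_ext (evaluates_lin (c i) (hE i) IH) => t.
  by rewrite big_cons.
have hx := xvarC; have hd := dvarC; have hdx := dxvar.
have hN a e : harmonic_null g xvar dvar (Lsq g L a e + s a e *: Lsq g L e a
    - (4 * critical F m n * (M - 1) * g e a) *: 1).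
  have := Lsq_wrot_sym hg hx hd hdx a e.
  have -> : 2 * (2 - M / 2) * g e a = 4 * critical F m n * (M - 1) * g e a.
    by rewrite /critical; field; rewrite subr_eq0.
  by [].
have [p [hp [p1 [p2 [p3 ep]]]]] := @J1_evaluates F m n g hg A L (wrotC xvar dvar)
  (wrot_comm hg hx hd hdx) (op4_alt hg hx hdx)
  (sl2_invariant g xvar dvar) (harmonic_null g xvar dvar) (sl2_invariant1 g xvar dvar)
  (wrot_invariant hg hx hd hdx) (@sl2_invariantD F m n g A xvar dvar)
  (@sl2_invariantZ F m n g A xvar dvar) (@sl2_invariantM F m n g A xvar dvar)
  (harmonic_null0 g xvar dvar) (@harmonic_nullD F m n g A xvar dvar)
  (@harmonic_nullZ F m n g A xvar dvar) (@harmonic_nullMl F m n g A xvar dvar)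
  (@harmonic_nullMr F m n g A xvar dvar) _ hN _ hJ.
move=> j.
(* Apply the identity to [fj j] and read position 0: [laplace] and [euler - w] annihilate [fj j],
   the image of [radius] vanishes at 0, and the other side is [c j] times [j!]. *)
have := congr1 (fun h : A => h (fj j) 0 : F) ep.
rewrite (evaluates_inj hp hS) !endoD !endoM laplace_fj endo0 endoD endoN euler_fj endoZ.
rewrite subrr endo0 addr0 addr0 radius_zero horner_sum endo_sum wspace_sum.
have hv i : (((c i *: (1 : A)) *: (op2 L Xg *: 'X) ^+ i).[1] (fj j) 0 : F)
    = c i * ((i == j :> nat) * j`!)%:R.
  have -> : ((c i *: (1 : A)) *: (op2 L Xg *: 'X) ^+ i).[1] = c i *: (op2 L Xg) ^+ i.
    rewrite hornerZ mulr_algl; congr (_ *: _); elim: (i : nat) => [|l IH]; first by rewrite hornerC.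
    by rewrite !exprS horner1M IH hornerZ hornerX mulr1.
  by rewrite endoZ -[LHS]/(c i * (((op2 L Xg) ^+ i) (fj j) 0 : F)) lower_power.
under eq_bigr => i _ do rewrite hv.
rewrite (bigD1 j) // big1 => [|i ij]; last by rewrite -val_eqE in ij; rewrite (negbTE ij) mulr0.
rewrite eqxx mul1n => e; have {e}: c j * (j`!)%:R + 0 = 0 := e.
move=> /eqP; rewrite addr0 mulf_eq0.
by rewrite pnatr_eq0 eqn0Ngt fact_gt0 orbF => /eqP.
Qed.
End InfiniteCodimension.

Lemma sdimE (F : numClosedFieldType) (m n : nat) : sdim F m n = (Mint m n)%:~R.
Proof.
rewrite /sdim big_split_ord /=.
rewrite (eq_bigr (fun _ => 1)) => [|i _]; last by rewrite /par /= leqNgt ltn_ord.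
rewrite [X in _ + X](eq_bigr (fun _ => -1)) => [|i _]; last by rewrite /par /= leq_addr.
by rewrite !sumr_const !card_ord rmorphB /= mulNrn -!pmulrn.
Qed.

Theorem theorem5p3 (F : numClosedFieldType) (m n : nat)
  (g : 'I_(m + n.*2) -> 'I_(m + n.*2) -> F) (hg : is_osp_metric g)
  (hm : (4 < m)%N) (hn : (1 < n)%N)
  (hM : Mint m n != 1 /\ Mint m n != 2) (lam : F) :
  (lam != joseph_lambda F m n -> lam != 0 ->
     forall t, @inTg F m n t -> J1 g lam t) /\
  (lam = 0 -> Mint m n != 4 ->
     forall t, J1 g lam t <-> augU g t) /\
  (lam = joseph_lambda F m n -> infinite_codim (J1 g lam)).
Proof.
have hM1 : sdim F m n != 1 by rewrite sdimE -[1]/(1%:~R) eqr_int; case: hM.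
have hM2 : sdim F m n != 2 by rewrite sdimE -[2]/(2%:~R) eqr_int; case: hM.
have lamE : joseph_lambda F m n = critical F m n.
  by rewrite /joseph_lambda /critical sdimE !rmorphB.
have hI : (0 < m + n.*2)%N by rewrite addn_gt0 (leq_trans _ hm).
split; first by rewrite lamE => hl hl0 t; apply: J_full.
split=> [l0 hM4 t|->]; last by rewrite lamE; apply: J1_infinite_codim.
(* The value 0 is critical only for [M = 4]. *)
apply: J_zero_aug => //; rewrite l0 /critical eq_sym oppr_eq0 mulf_eq0 invr_eq0 mulf_eq0.
rewrite pnatr_eq0 !subr_eq0 (negbTE hM1) !orbF sdimE.
by rewrite -[4]/(4%:~R) eqr_int.
Qed.
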